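(* Let $k,d\ge1$ be integers with $k\ge d+1$. For a finite abelian group $G$, a subset $A\subseteq G$ and $\delta=|A|/|G|$, consider the following properties, each depending on a parameter $c_i\in(0,1]$: (i) $\|A-\delta\|_{U^{d+1}}\le c_1$; (ii) $\mathbb{P}_{\mathbf{x}\in G^{\mathcal{J}_{k,d}}}\big(\phi_\sigma(\mathbf{x})\in A\ \text{for all }\sigma\in\{0,1\}^{\binom{[k]}{d}}\big)\le\delta^{2^{\binom{k}{d}}}+c_2$; (iii) $\|\Gamma^{(k)}_A-\delta\|_{\square^k_d}\le c_3$; (iv) $t(F,\Gamma^{(k)}_A)=\delta^{e(F)}\pm e(F)c_4$ for every $d$-linear $k$-graph $F$; (v) $t(F,\Gamma^{(k)}_A)=\delta^{e(F)}\pm e(F)c_5$ for every $(d+1)$-simple $k$-graph $F$; (vi) $t(\mathrm{Oct}^{(k)}_{d+1},\Gamma^{(k)}_A)\le\delta^{2^{d+1}}+c_6$; (vii) $\mathrm{dev}_{d+1}(\Gamma^{(k)}_A)\le c_7$. Then these seven properties are pairwise polynomially equivalent: there is a constant $K=K(k,d)>0$ such that for every $\varepsilon\in(0,1]$, every finite abelian group $G$ with $|G|\ge K/\varepsilon^K$, every $A\subseteq G$ and every pair $i,j\in\{1,\dots,7\}$, if property $(i$-th$)$ holds with $c_i\le\varepsilon^K/K$ then property $(j$-th$)$ holds with $c_j=\varepsilon$.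
   Context: Sets are identified with their indicator functions; $\mathbb{E}_{x\in X}$ denotes the average over a finite set $X$; $a=b\pm c$ means $b-c\le a\le b+c$. For $f:G\to\mathbb{R}$ and $m\ge2$, $\|f\|_{U^m}=\big(\mathbb{E}_{x,h_1,\dots,h_m\in G}\prod_{\omega\in\{0,1\}^m}f(x+\sum_i\omega_ih_i)\big)^{1/2^m}$. For $1\le d<k$ and $f:V^k\to\mathbb{R}$, $\|f\|_{\square^k_d}=\max|\mathbb{E}_{\mathbf{x}\in V^k}[f(\mathbf{x})\prod_{B\in\binom{[k]}{d}}S_B(\mathbf{x}_B)]|$ over all families $S_B\subseteq V^B$, with $\mathbf{x}_B=(x_j)_{j\in B}$. The Cayley $k$-graph $\Gamma^{(k)}_A$ has vertex set $G$ and edge indicator $\Gamma^{(k)}_A(x_1,\dots,x_k)=A(x_1+\dots+x_k)$ on $G^k$. For a $k$-uniform hypergraph $F$ (edges are $k$-element subsets of $V(F)$) and $H:V^k\to\mathbb{R}$ symmetric, the homomorphism density is $t(F,H)=\mathbb{E}_{\mathbf{x}\in V^{V(F)}}\prod_{e\in E(F)}H(\mathbf{x}_e)$. $F$ is $d$-linear if any two distinct edges share at most $d$ vertices; $F$ is $s$-simple if every edge $e$ contains an $s$-set of vertices not contained in any other edge. The squashed octahedron $\mathrm{Oct}^{(k)}_{d+1}$ is the $k$-graph on vertices $x^{(0)}_1,x^{(1)}_1,\dots,x^{(0)}_{d+1},x^{(1)}_{d+1},y_{d+2},\dots,y_k$ whose edges are $\{x^{(\omega_1)}_1,\dots,x^{(\omega_{d+1})}_{d+1},y_{d+2},\dots,y_k\}$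 for $\omega\in\{0,1\}^{d+1}$ (for $k=d+1$ this is the $k$-octahedron, with no $y$'s). The $(d+1)$-deviation of a $k$-graph $H$ on vertex set $V$ with edge density $\delta(H)$ is $\mathrm{dev}_{d+1}(H)=\mathbb{E}_{\mathbf{x}^{(0)},\mathbf{x}^{(1)}\in V^{d+1}}\mathbb{E}_{y_{d+2},\dots,y_k\in V}\prod_{\omega\in\{0,1\}^{d+1}}\big(H(x^{(\omega_1)}_1,\dots,x^{(\omega_{d+1})}_{d+1},y_{d+2},\dots,y_k)-\delta(H)\big)$; the edge density of $\Gamma^{(k)}_A$ is $|A|/|G|$. The linear system $\Phi_{k,d}$: variables are indexed by $\mathcal{J}_{k,d}=\bigcup_{j=1}^k\{\tau:\binom{[k]\setminus\{j\}}{d}\to\{0,1\}\}$ (so there are $k2^{\binom{k-1}{d}}$ variables), and for each $\sigma:\binom{[k]}{d}\to\{0,1\}$ there is a linear form $\phi_\sigma((x_\tau)_{\tau\in\mathcal{J}_{k,d}})=\sum_{j=1}^k x_{\sigma_{-j}}$, where $\sigma_{-j}$ is the restriction of $\sigma$ to $\binom{[k]\setminus\{j\}}{d}$. *)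

(* Defs.v *)
From HB Require Import structures.
From mathcomp Require Import all_boot all_order all_algebra.
From mathcomp Require Import reals exp.
Set Implicit Arguments. Unset Strict Implicit. Unset Printing Implicit Defensive.
Import Order.TTheory GRing.Theory Num.Theory.
Local Open Scope ring_scope.

Section Defs.
Variable R : realType.

Definition avg (T : finType) (f : T -> R) : R := (\sum_(x : T) f x) / #|T|%:R.

Variable G : finZmodType.

Definition density (A : {set G}) : R := #|A|%:R / #|G|%:R.

Definition gowers (m : nat) (f : G -> R) : R :=
  (avg (fun x : G => avg (fun h : {ffun 'I_m -> G} =>
     \prod_(w : {ffun 'I_m -> bool}) f (x + \sum_(i < m | w i) h i))))
  `^ (2 ^- m).

Definition dsets (k d : nat) := {B : {set 'I_k} | #|B| == d}.
Definition dsets_out (k d : nat) (j : 'I_k) :=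
  {B : {set 'I_k} | (#|B| == d) && (j \notin B)}.

Arguments dsets_out : clear implicits.

Lemma dsets_out_card k d j (B : dsets_out k d j) : #|val B| == d.
Proof. by case/andP: (valP B). Qed.

Definition restr k d (s : {ffun dsets k d -> bool}) (j : 'I_k)
  : {ffun dsets_out k d j -> bool} :=
  [ffun B => s (exist _ (val B) (dsets_out_card B))].

Definition Jkd (k d : nat) := {j : 'I_k & {ffun dsets_out k d j -> bool}}.

Definition phi k d (s : {ffun dsets k d -> bool}) (x : {ffun Jkd k d -> G}) : G :=
  \sum_(j < k) x (Tagged (fun j => {ffun dsets_out k d j -> bool}) (restr s j)).

Definition cayley (k : nat) (A : {set G}) (x : {ffun 'I_k -> G}) : R :=
  ((\sum_(i < k) x i) \in A)%:R.

Definition restrx k (B : {set 'I_k}) (x : {ffun 'I_k -> G})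
  : {ffun {i : 'I_k | i \in B} -> G} := [ffun i => x (val i)].

Definition cutnorm (k d : nat) (f : {ffun 'I_k -> G} -> R) : R :=
  \big[Num.max/0]_(S : {dffun forall B : dsets k d,
                               {set {ffun {i : 'I_k | i \in val B} -> G}}})
    `| avg (fun x : {ffun 'I_k -> G} =>
          f x * \prod_(B : dsets k d) (restrx (val B) x \in S B)%:R) |.

Definition kgraph (k n : nat) (E : {set {set 'I_n}}) : bool :=
  [forall e in E, #|e| == k].

(* x_e, listing the vertices of e in increasing order *)
Definition edge_tuple (k n : nat) (x : {ffun 'I_n -> G}) (e : {set 'I_n})
  : {ffun 'I_k -> G} := [ffun i : 'I_k => nth 0 [seq x v | v <- enum e] i].

Definition hom_density (k n : nat) (E : {set {set 'I_n}})
  (H : {ffun 'I_k -> G} -> R) : R :=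
  avg (fun x : {ffun 'I_n -> G} => \prod_(e in E) H (edge_tuple k x e)).

End Defs.

Definition dlinear (d n : nat) (E : {set {set 'I_n}}) : bool :=
  [forall e1 in E, forall e2 in E, (e1 != e2) ==> (#|e1 :&: e2| <= d)%N].

Definition ssimple (s n : nat) (E : {set {set 'I_n}}) : bool :=
  [forall e in E, exists S : {set 'I_n},
     [&& S \subset e, #|S| == s :> nat & [forall e' in E, (e' != e) ==> ~~ (S \subset e')]]].

(* squashed octahedron Oct^{(k)}_{d+1}: vertices x^{(b)}_i = 2i+b (i < d+1),
   y's = 2(d+1), ..., 2(d+1) + (k-d-2); n = 2(d+1) + (k-(d+1)) *)
Definition oct_n (k d : nat) := (2 * d.+1 + (k - d.+1))%N.
Definition oct_edge (k d : nat) (w : {ffun 'I_d.+1 -> bool}) : {set 'I_(oct_n k d)} :=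
  [set v : 'I_(oct_n k d) |
     [exists i : 'I_d.+1, val v == (2 * i + w i)%N] || (2 * d.+1 <= val v)%N].
Arguments oct_edge : clear implicits.
Definition oct (k d : nat) : {set {set 'I_(oct_n k d)}} :=
  [set oct_edge k d w | w : {ffun 'I_d.+1 -> bool}].

Section Dev.
Variable R : realType.
Variable G : finZmodType.

Definition dev (k d : nat) (H : {ffun 'I_k -> G} -> R) (delta : R) : R :=
  avg (fun x0 : d.+1.-tuple G => avg (fun x1 : d.+1.-tuple G =>
  avg (fun y : (k - d.+1).-tuple G =>
    \prod_(w : {ffun 'I_d.+1 -> bool})
      (H [ffun i : 'I_k =>
            if (i < d.+1)%N then nth 0 (if w (inord i) then x1 else x0) i
            else nth 0 y (i - d.+1)] - delta)))).

Definition prop (k d : nat) (A : {set G}) (i : 'I_7) (c : R) : Prop :=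
  let delta := density R A in
  let Gam := @cayley R G k A in
  match val i with
  | 0 => gowers d.+1 (fun x => (x \in A)%:R - delta) <= c
  | 1 => avg (fun x : {ffun Jkd k d -> G} =>
            [forall s : {ffun dsets k d -> bool}, phi s x \in A]%:R)
         <= delta ^+ (2 ^ 'C(k, d)) + c
  | 2 => cutnorm d (fun x => Gam x - delta) <= c
  | 3 => forall (n : nat) (E : {set {set 'I_n}}), kgraph k E -> dlinear d E ->
           `| hom_density E Gam - delta ^+ #|E| | <= #|E|%:R * c
  | 4 => forall (n : nat) (E : {set {set 'I_n}}), kgraph k E -> ssimple d.+1 E ->
           `| hom_density E Gam - delta ^+ #|E| | <= #|E|%:R * c
  | 5 => hom_density (oct k d) Gam <= delta ^+ (2 ^ d.+1) + c
  | _ => dev d Gam delta <= c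
  end.
End Dev.

(* Main.v *)
From HB Require Import structures.
Require Import Defs.
From mathcomp Require Import all_boot all_order all_algebra.
From mathcomp Require Import boolp reals exp.
From mathcomp Require Import zify ring lra.
Set Implicit Arguments. Unset Strict Implicit. Unset Printing Implicit Defensive.
Import Order.TTheory GRing.Theory Num.Theory.
Local Open Scope ring_scope.

(** Every property is compared with the smallness of the norm [U^{d+1}] of the
    balanced function [f = 1_A - delta].

    From [U^{d+1}] to the others: applying Cauchy-Schwarz once in each of [d+1]
    directions bounds any average of [f (l x)] against bounded functions, each
    invariant under one of the directions, by the norm of [f].  This controls the
    cut norm and, replacing edges one at a time, the density of every
    [(d+1)]-simple hypergraph.  The deviation is a power of the norm.

    The system [Phi_{k,d}] is obtained from the form [x_1 + ... + x_k] by doubling,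
    for each [d]-set [B], the coordinates outside [B].  If the count is nearly
    minimal, then so are the counts after every subfamily of doublings, and
    expanding [(g - a)(g' - a)], [a] the average of [g], around the averages of
    [g g'], [g] and [g'] shows inductively that [f (x_1 + ... + x_k)] is nearly
    orthogonal to products of functions of [d] coordinates.  For [k = d+1] the
    system is the octahedron.

    It remains to bound the norm of [f] by such correlations when [k > d+1].
    Splitting the [k] coordinates into [d+1] blocks, the [2^{d+1}]-th power of the
    norm is an average of correlations of [f (x_1 + ... + x_k)] with functions of
    sets of coordinates that miss a block.  Those sets that have more than [d]
    elements are removed one after the other: Cauchy-Schwarz, with the coordinates
    in [I] fixed, trades a function of [x_I] for functions of proper subsets of
    [I]. *)

(** Function spaces and products become finite groups, so that averages over them can be
    translated. *)
HB.instance Definition _ (I : finType) (G : finZmodType) :=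
  Finite.on {ffun I -> G}.
HB.instance Definition _ (G H : finZmodType) := Finite.on (G * H)%type.

(** * Averages *)

Section Average.
Variable R : realType.
Implicit Types T U : finType.

Lemma eq_avg T (f g : T -> R) : f =1 g -> avg f = avg g.
Proof. by move=> fg; rewrite /avg (eq_bigr g). Qed.

Lemma avgD T (f g : T -> R) : avg (fun x => f x + g x) = avg f + avg g.
Proof. by rewrite /avg big_split mulrDl. Qed.

Lemma avgZ T c (f : T -> R) : avg (fun x => c * f x) = c * avg f.
Proof. by rewrite /avg -mulr_sumr mulrA. Qed.

Lemma avgZr T c (f : T -> R) : avg (fun x => f x * c) = avg f * c.
Proof. by rewrite mulrC -avgZ; apply: eq_avg => x; rewrite mulrC. Qed.

Lemma avgB T (f g : T -> R) : avg (fun x => f x - g x) = avg f - avg g.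
Proof.
rewrite avgD; congr (_ + _); rewrite -mulN1r -avgZ.
by apply: eq_avg => x; rewrite mulN1r.
Qed.

Lemma exchange_avg T U (f : T -> U -> R) :
  avg (fun x => avg (f x)) = avg (fun y => avg (f^~ y)).
Proof.
rewrite /avg -!mulr_suml exchange_big /= -!mulrA; congr (_ * _).
exact: mulrC.
Qed.

Lemma avg_pair T U (f : T * U -> R) :
  avg f = avg (fun x => avg (fun y => f (x, y))).
Proof.
rewrite /avg -mulr_suml -mulrA -invfM mulrC card_prod natrM [in RHS]mulrC.
rewrite pair_big /= [_%:R * _]mulrC; congr (_ * _).
by apply: eq_bigr => -[].
Qed.

Lemma avg_bij T U (h : U -> T) (f : T -> R) :
  bijective h -> avg f = avg (f \o h).
Proof.
move=> bh; rewrite /avg (reindex h) /=; last exact: onW_bij.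
by rewrite (bij_eq_card bh).
Qed.

(** The point [x0] rules out the empty type, over which every average is 0. *)
Lemma avg_cst T (x0 : T) (c : R) : avg (fun _ : T => c) = c.
Proof.
rewrite /avg sumr_const -[c *+ _]mulr_natr mulfK // pnatr_eq0 -lt0n.
by apply/card_gt0P; exists x0.
Qed.

Lemma ler_avg T (f g : T -> R) : (forall x, f x <= g x) -> avg f <= avg g.
Proof. by move=> fg; rewrite ler_wpM2r ?invr_ge0 ?ler0n // ler_sum. Qed.

Lemma avg_ge0 T (f : T -> R) : (forall x, 0 <= f x) -> 0 <= avg f.
Proof. by move=> f0; rewrite mulr_ge0 ?invr_ge0 ?ler0n // sumr_ge0. Qed.

Lemma ler_norm_avg T (f : T -> R) : `|avg f| <= avg (fun x => `|f x|).
Proof.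
rewrite /avg normrM [X in _ * X <= _]ger0_norm ?invr_ge0 ?ler0n //.
by rewrite ler_wpM2r ?invr_ge0 ?ler0n // ler_norm_sum.
Qed.

Lemma avg_le T (f : T -> R) c : 0 <= c -> (forall x, f x <= c) -> avg f <= c.
Proof.
move=> c0 fc; have [x0|T0] := pickP (predT : pred T).
  by rewrite -[leRHS](avg_cst x0) ler_avg.
by rewrite /avg big1 ?mul0r // => x; have := T0 x.
Qed.

(** The variance of [f] is nonnegative. *)
Lemma avg_sqr_le T (f : T -> R) : avg f ^+ 2 <= avg (fun x => f x ^+ 2).
Proof.
have [x0 _|T0] := pickP (predT : pred T); last first.
  by rewrite /avg !big1 ?mul0r ?expr0n // => x; have := T0 x.
have: 0 <= avg (fun x => (f x - avg f) ^+ 2).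
  by apply: avg_ge0 => x; exact: sqr_ge0.
rewrite (@eq_avg _ _ (fun x => f x ^+ 2 + (- 2 * avg f * f x + avg f ^+ 2))).
  by rewrite !avgD avgZ (avg_cst x0); lra.
by move=> x; ring.
Qed.

Lemma avg_expn2_le T (f : T -> R) n :
  avg f ^+ (2 ^ n) <= avg (fun x => f x ^+ (2 ^ n)).
Proof.
(* Exponent 1 is treated apart because [f] may be negative; from exponent 2 on, both sides of the
   induction hypothesis are nonnegative and can be squared. *)
case: n => [|n]; first by rewrite expr1.
elim: n => [|n IHn]; first exact: avg_sqr_le.
rewrite expnSr exprM.
apply: le_trans (_ : avg (fun x => f x ^+ (2 ^ n.+1)) ^+ 2 <= _).
  apply: lerXn2r; rewrite ?nnegrE //.
  - by rewrite expnS exprM exprn_ge0 ?sqr_ge0.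
  - by apply: avg_ge0 => x; rewrite expnS exprM exprn_ge0 ?sqr_ge0.
apply: le_trans (avg_sqr_le _) _.
by apply: ler_avg => x; rewrite -exprM.
Qed.

Lemma avg_shift (X : finZmodType) a (f : X -> R) :
  avg f = avg (fun x => f (x + a)).
Proof.
apply: (@avg_bij X X (fun x => x + a)).
by exists (fun x => x - a) => x; rewrite ?addrK ?subrK.
Qed.

(* [e] is any section of a group epimorphism, hence the push-forward of the
   uniform distribution is uniform. *)
Lemma avg_proj (X Z : finZmodType) (p : X -> Z) (e : Z -> X) (f : Z -> R) :
  (forall x z, p (x + e z) = p x + z) -> avg (fun x => f (p x)) = avg f.
Proof.
move=> pe; transitivity (avg (fun z => avg (fun x => f (p (x + e z))))).
  by rewrite -[LHS](avg_cst (0 : Z)); apply: eq_avg => z; exact: avg_shift.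
rewrite exchange_avg -[RHS](avg_cst (0 : X)); apply: eq_avg => x.
rewrite [RHS](avg_shift (p x)); apply: eq_avg => z.
by rewrite pe addrC.
Qed.

End Average.

(** * Products of bounded functions *)

Section BoundedProducts.
Variables (R : realType) (X : Type).
Implicit Types (P Q : (X -> R) -> Prop) (u v U V : X -> R).

Definition bounded1 u := forall x, `|u x| <= 1.

(** Only the existence of a finite factorisation is recorded, so that products can be regrouped and
    substituted into without carrying an index set. *)
Inductive bprod P : (X -> R) -> Prop :=
| bprod1 : bprod P (fun=> 1)
| bprodS u U : P u -> bounded1 u -> bprod P U -> bprod P (fun x => u x * U x).

Lemma bprod_base P u : P u -> bounded1 u -> bprod P u.
Proof.
move=> Pu u1; have := bprodS Pu u1 (bprod1 P).
by congr bprod; apply: funext => x; rewrite mulr1.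
Qed.

Lemma bprodM P U V : bprod P U -> bprod P V -> bprod P (fun x => U x * V x).
Proof.
move=> PU PV; elim: PU => [|u W Pu u1 _ IH].
  by have := PV; congr bprod; apply: funext => x; rewrite mul1r.
have := bprodS Pu u1 IH.
by congr bprod; apply: funext => x; rewrite mulrA.
Qed.

Lemma bprod_prod P (I : eqType) (r : seq I) (p : pred I) (F : I -> X -> R) :
  (forall i, i \in r -> p i -> bprod P (F i)) ->
  bprod P (fun x => \prod_(i <- r | p i) F i x).
Proof.
elim: r => [|i r IHr] PF.
  by have := bprod1 P; congr bprod; apply: funext => x; rewrite big_nil.
have {}IHr := IHr (fun j jr => PF j (mem_behead (s := i :: r) jr)).
have [pi|pi] := boolP (p i).
  have := bprodM (PF i (mem_head _ _) pi) IHr; congr bprod.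
  by apply: funext => x; rewrite big_cons pi.
by have := IHr; congr bprod; apply: funext => x; rewrite big_cons (negbTE pi).
Qed.

Lemma bprod_sub P Q U : (forall u, P u -> Q u) -> bprod P U -> bprod Q U.
Proof.
move=> PQ; elim=> [|u V Pu u1 _ IH]; first exact: bprod1.
by apply: bprodS => //; exact: PQ.
Qed.

(** Factors of the same class are multiplied together, which leaves one bounded factor per index, as
    the Cauchy-Schwarz and cut norm arguments expect. *)
Lemma bprod_collect (I : finType) (Q : I -> (X -> R) -> Prop) U :
  (forall i, Q i (fun=> 1)) ->
  (forall i u v, Q i u -> Q i v -> Q i (fun x => u x * v x)) ->
  bprod (fun u => exists i, Q i u) U ->
  exists2 v : I -> X -> R, forall i, Q i (v i) /\ bounded1 (v i)
                         & forall x, U x = \prod_i v i x.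
Proof.
move=> Q1 QM; elim=> [|u V [i Qu] u1 _ [v vP VE]].
  exists (fun _ _ => 1) => [i|x]; last by rewrite big1.
  by split=> // x; rewrite normr1.
exists (fun j => if j == i then fun x => u x * v i x else v j) => [j|x].
  case: eqP => [->|_]; last exact: vP.
  have [Qv v1] := vP i; split=> [|x]; first exact: QM.
  by rewrite normrM mulr_ile1.
rewrite VE (bigD1 i) //= [in RHS](bigD1 i) //= eqxx mulrA; congr (_ * _).
by apply: eq_bigr => j /negbTE ->.
Qed.

End BoundedProducts.

(** * Gowers averages and the generalised von Neumann inequality *)

Section FfunCons.
Variable T : finType.

Definition fcons m (t : T) (h : {ffun 'I_m -> T}) : {ffun 'I_m.+1 -> T} :=
  [ffun i => oapp h t (unlift ord0 i)].

Lemma fcons0 m t (h : {ffun 'I_m -> T}) : fcons t h ord0 = t.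
Proof. by rewrite ffunE unlift_none. Qed.

Lemma fconsS m t (h : {ffun 'I_m -> T}) i : fcons t h (lift ord0 i) = h i.
Proof. by rewrite ffunE liftK. Qed.

Lemma fcons_bij m :
  bijective (fun p : T * {ffun 'I_m -> T} => fcons p.1 p.2).
Proof.
exists (fun h : {ffun 'I_m.+1 -> T} => (h ord0, [ffun i => h (lift ord0 i)])).
  move=> [t h] /=; rewrite fcons0; congr pair.
  by apply/ffunP => i; rewrite ffunE fconsS.
move=> h /=; apply/ffunP => i; rewrite ffunE.
by case: unliftP => [j|] -> //=; rewrite ffunE.
Qed.

Lemma prod_fcons (R : comPzRingType) m (F : {ffun 'I_m.+1 -> T} -> R) :
  \prod_w F w = \prod_t \prod_(w : {ffun 'I_m -> T}) F (fcons t w).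
Proof.
rewrite (reindex (fun p : T * {ffun 'I_m -> T} => fcons p.1 p.2)) /=.
  by rewrite [RHS]pair_big.
exact/onW_bij/fcons_bij.
Qed.

End FfunCons.

Section VonNeumann.
Variables (R : realType).

(** The Gowers average before the root is taken; in this form it obeys the exact recursion
    [gavgS]. *)
Definition gavg (G : finZmodType) m (f : G -> R) : R :=
  avg (fun x : G => avg (fun h : {ffun 'I_m -> G} =>
    \prod_(w : {ffun 'I_m -> bool}) f (x + \sum_(i < m | w i) h i))).

Lemma gavg0 (G : finZmodType) (f : G -> R) : gavg 0 f = avg f.
Proof.
have no : forall i : 'I_0, False by case.
apply: eq_avg => x; rewrite -[RHS](avg_cst [ffun i => False_rect G (no i)]).
apply: eq_avg => h; rewrite (big_pred1 [ffun i => False_rect _ (no i)]).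
  by rewrite big_ord0 addr0.
by move=> w /=; apply/esym/eqP/ffunP => -[].
Qed.

(** Splitting off the first direction [t] pairs each vertex of the cube with its translate by [t],
    which replaces [f] by its multiplicative derivative. *)
Lemma gavgS (G : finZmodType) m (f : G -> R) :
  gavg m.+1 f = avg (fun t => gavg m (fun x => f x * f (x + t))).
Proof.
rewrite /gavg exchange_avg; apply: eq_avg => x.
rewrite (avg_bij _ (fcons_bij _ _)) avg_pair; apply: eq_avg => t.
apply: eq_avg => h /=; rewrite prod_fcons big_bool /= mulrC -big_split /=.
apply: eq_bigr => w _.
have sumE b : \sum_(i < m.+1 | fcons b w i) fcons t h i =
    (if b then t else 0) + \sum_(i < m | w i) h i.
  rewrite big_mkcond big_ord_recl !fcons0 [in RHS]big_mkcond; congr (_ + _).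
  by apply: eq_bigr => i _; rewrite !fconsS.
by rewrite !sumE add0r [t + _]addrC addrA.
Qed.

Lemma gavg1 (G : finZmodType) (f : G -> R) : gavg 1 f = avg f ^+ 2.
Proof.
rewrite gavgS; under eq_avg do rewrite gavg0.
rewrite exchange_avg expr2 -avgZr; apply: eq_avg => x.
by rewrite avgZ [in RHS](avg_shift x); under [in RHS]eq_avg do rewrite addrC.
Qed.

Lemma gavg_ge0 (G : finZmodType) m (f : G -> R) : 0 <= gavg m.+1 f.
Proof.
elim: m f => [|m IHm] f; first by rewrite gavg1 sqr_ge0.
by rewrite gavgS; apply: avg_ge0.
Qed.

(** Cauchy-Schwarz along the orbits of [e]. An invariant weight sees [F] only through the orbit
    average [h]; as [h] is itself invariant, the same exchange turns [h * h] back into a correlation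
    of [F] with its translates. *)
Lemma avg_invariant_sqr_le (X Z : finZmodType) (e : Z -> X) (u F : X -> R) :
  (forall s t, e (s + t) = e s + e t) ->
  (forall x t, u (x + e t) = u x) -> bounded1 u ->
  avg (fun x => u x * F x) ^+ 2 <=
  avg (fun t => avg (fun x => F x * F (x + e t))).
Proof.
move=> eD ue u1; pose h x := avg (fun t => F (x + e t)).
have he x t : h (x + e t) = h x.
  by rewrite /h [RHS](avg_shift t); apply: eq_avg => s; rewrite -addrA eD addrC
    [e s + _]addrC addrC.
have wF w : (forall x t, w (x + e t) = w x) ->
    avg (fun x => w x * F x) = avg (fun x => w x * h x).
  move=> we; rewrite -[LHS](avg_cst (0 : Z)).
  under eq_avg => t do rewrite (avg_shift (e t)).
  rewrite exchange_avg; apply: eq_avg => x.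
  by under eq_avg do rewrite we; rewrite avgZ.
rewrite wF //; apply: le_trans (avg_sqr_le _) _.
apply: le_trans (_ : avg (fun x => h x * h x) <= _).
  apply: ler_avg => x; rewrite exprMn -expr2 ler_piMl ?sqr_ge0 //.
  by rewrite -real_normK ?num_real // exprn_ile1.
rewrite -wF // exchange_avg; apply: ler_avg => x.
by rewrite avgZ mulrC.
Qed.

(** Induction on the number of directions. Cauchy-Schwarz in direction [ord0] removes its factor,
    turns [f] into the derivative of [gavgS], and turns every other factor into a product with its
    translate, which is still bounded and invariant under its own direction. *)
Lemma von_neumann (G : finZmodType) m (f : G -> R) (X : finZmodType)
    (l : X -> G) (e : 'I_m.+1 -> G -> X) (u : 'I_m.+1 -> X -> R) :
  (forall i s t, e i (s + t) = e i s + e i t) ->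
  (forall i x t, l (x + e i t) = l x + t) ->
  (forall i x t, u i (x + e i t) = u i x) -> (forall i, bounded1 (u i)) ->
  `|avg (fun x => f (l x) * \prod_i u i x)| ^+ (2 ^ m.+1) <= gavg m.+1 f.
Proof.
elim: m f e u => [|m IHm] f e u eD le ue u1.
  rewrite expn1 real_normK ?num_real //.
  under eq_avg do rewrite big_ord1 mulrC.
  apply: le_trans (avg_invariant_sqr_le (f \o l) (eD ord0) (ue ord0) (u1 _)) _.
  rewrite gavgS; apply: ler_avg => t; rewrite gavg0 /=.
  (* Moving along [e ord0] translates [l x] by an arbitrary amount, hence [l x] is uniformly
     distributed. *)
  rewrite -(avg_proj (fun x => f x * f (x + t)) (le ord0)).
  by under eq_avg do rewrite le.
rewrite expnS exprM real_normK ?num_real //.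
pose F x := f (l x) * \prod_(i < m.+1) u (lift ord0 i) x.
under eq_avg => x do rewrite big_ord_recl mulrCA -/(F x).
apply: le_trans (_ : avg (fun t => avg (fun x => F x * F (x + e ord0 t)))
    ^+ (2 ^ m.+1) <= _).
  apply: lerXn2r; rewrite ?nnegrE ?sqr_ge0 //; last first.
    exact: avg_invariant_sqr_le.
  exact: le_trans (sqr_ge0 _) (avg_invariant_sqr_le _ (eD ord0) (ue ord0) (u1 _)).
apply: le_trans (avg_expn2_le _ _) _.
rewrite gavgS; apply: ler_avg => t.
have even_norm (z : R) : z ^+ (2 ^ m.+1) = `|z| ^+ (2 ^ m.+1).
  by rewrite expnS !exprM real_normK ?num_real.
rewrite even_norm.
have := IHm (fun x => f x * f (x + t)) (fun i => e (lift ord0 i))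
  (fun i x => u (lift ord0 i) x * u (lift ord0 i) (x + e ord0 t)).
rewrite /F; under eq_avg do rewrite big_split /=.
under [in X in _ -> X]eq_avg do rewrite mulrACA (le ord0).
apply=> // i x; last by rewrite normrM mulr_ile1 ?u1.
by move=> s; rewrite ue addrAC ue.
Qed.

Lemma von_neumann_bprod (G : finZmodType) m (f : G -> R) (X : finZmodType)
    (l : X -> G) (e : 'I_m.+1 -> G -> X) (U : X -> R) :
  (forall i s t, e i (s + t) = e i s + e i t) ->
  (forall i x t, l (x + e i t) = l x + t) ->
  bprod (fun u => exists i, forall x t, u (x + e i t) = u x) U ->
  `|avg (fun x => f (l x) * U x)| ^+ (2 ^ m.+1) <= gavg m.+1 f.
Proof.
move=> eD le Uprod.
have [||u uP UE] := bprod_collect _ _ Uprod => // [i u v ui vi x t|].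
  by rewrite ui vi.
under eq_avg do rewrite UE.
by apply: (von_neumann _ eD le) => i; have [] := uP i.
Qed.

Lemma gowersX (G : finZmodType) m (f : G -> R) :
  gowers m.+1 f ^+ (2 ^ m.+1) = gavg m.+1 f.
Proof.
rewrite /gowers -/(gavg m.+1 f) -powR_mulrn ?powR_ge0 // -powRrM.
by rewrite natrX mulVf ?powRr1 ?gavg_ge0 // expf_neq0 // pnatr_eq0.
Qed.

Lemma gowers_le (G : finZmodType) m (f : G -> R) c : 0 <= c ->
  (gowers m.+1 f <= c) = (gavg m.+1 f <= c ^+ (2 ^ m.+1)).
Proof.
by move=> c0; rewrite -gowersX ler_pXn2r ?nnegrE ?powR_ge0 ?expn_gt0.
Qed.

End VonNeumann.

(** * Iterated doublings with nearly minimal average *)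

Section Doubling.
Variables (R : realType) (k : nat).
Implicit Types (Y : finType) (B J : {set 'I_k}).

Definition depends_on Y J (u : {ffun 'I_k -> Y} -> R) :=
  forall x y : {ffun 'I_k -> Y}, (forall j, j \in J -> x j = y j) -> u x = u y.

Lemma depends_onM Y J (u v : {ffun 'I_k -> Y} -> R) :
  depends_on J u -> depends_on J v -> depends_on J (fun x => u x * v x).
Proof. by move=> du dv x y xy; rewrite (du x y) // (dv x y). Qed.

Lemma depends_onS Y J J' (u : {ffun 'I_k -> Y} -> R) :
  J \subset J' -> depends_on J u -> depends_on J' u.
Proof. by move=> /subsetP JJ' du x y xy; apply: du => j /JJ'/xy. Qed.

Definition sel Y B (x y : {ffun 'I_k -> Y}) : {ffun 'I_k -> Y} :=
  [ffun j => if j \in B then x j else y j].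

Definition fst_ffun Y (z : {ffun 'I_k -> Y * Y}) := [ffun j => (z j).1].
Definition sel_ffun Y B (z : {ffun 'I_k -> Y * Y}) :=
  [ffun j => if j \in B then (z j).1 else (z j).2].

Lemma avg_pair_ffun Y (F : {ffun 'I_k -> Y * Y} -> R) :
  avg F = avg (fun a : {ffun 'I_k -> Y} => avg (fun b : {ffun 'I_k -> Y} =>
    F [ffun j => (a j, b j)])).
Proof.
rewrite (@avg_bij _ _ ({ffun 'I_k -> Y} * {ffun 'I_k -> Y})%type
  (fun p => [ffun j => (p.1 j, p.2 j)])) ?avg_pair //.
exists (fun z : {ffun 'I_k -> Y * Y} => (fst_ffun z, [ffun j => (z j).2])) => [[a b]|z].
  by congr pair; apply/ffunP => j; rewrite !ffunE.
by apply/ffunP => j; rewrite !ffunE; case: (z j).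
Qed.

Lemma fst_ffun_pair Y (a b : {ffun 'I_k -> Y}) :
  fst_ffun [ffun j => (a j, b j)] = a.
Proof. by apply/ffunP => j; rewrite !ffunE. Qed.

Lemma sel_ffun_pair Y B (a b : {ffun 'I_k -> Y}) :
  sel_ffun B [ffun j => (a j, b j)] = sel B a b.
Proof. by apply/ffunP => j; rewrite !ffunE. Qed.

(** Two independent points may exchange their coordinates outside [B]: this is an involution of the
    pairs. *)
Lemma avg_sel_swap Y B (F : {ffun 'I_k -> Y} -> {ffun 'I_k -> Y} -> R) :
  avg (fun a => avg (F a)) = avg (fun a => avg (fun b => F (sel B a b) (sel B b a))).
Proof.
rewrite -!(avg_pair (fun p => F p.1 p.2)).
rewrite -(avg_pair (fun p => F (sel B p.1 p.2) (sel B p.2 p.1))).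
apply: (@avg_bij _ _ _ (fun p => (sel B p.1 p.2, sel B p.2 p.1))).
by apply: inv_bij => -[a b] /=; congr pair; apply/ffunP => j; rewrite !ffunE;
  case: (j \in B).
Qed.

Definition dbl Y B (g : {ffun 'I_k -> Y} -> R) (z : {ffun 'I_k -> Y * Y}) : R :=
  g (fst_ffun z) * g (sel_ffun B z).

Lemma avg_dbl Y B (g : {ffun 'I_k -> Y} -> R) :
  avg (dbl B g) = avg (fun a => avg (fun b => g a * g (sel B a b))).
Proof.
rewrite avg_pair_ffun; apply: eq_avg => a; apply: eq_avg => b.
by rewrite /dbl fst_ffun_pair sel_ffun_pair.
Qed.

(** The conditional expectation of [F] given the coordinates in [B]. *)
Definition avg_rest Y B (F : {ffun 'I_k -> Y} -> R) a := avg (fun b => F (sel B a b)).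

Lemma depends_on_avg_rest Y B (F : {ffun 'I_k -> Y} -> R) :
  depends_on B (avg_rest B F).
Proof.
move=> a a' aa'; apply: eq_avg => b; congr F.
by apply/ffunP => j; rewrite !ffunE; case: ifP => // /aa'.
Qed.

Lemma avg_depends_on Y B (w F : {ffun 'I_k -> Y} -> R) : depends_on B w ->
  avg (fun x => w x * F x) = avg (fun x => w x * avg_rest B F x).
Proof.
move=> dw; transitivity
    (avg (fun a => avg (fun _ : {ffun 'I_k -> Y} => w a * F a))).
  by apply: eq_avg => a; rewrite (avg_cst a).
rewrite (avg_sel_swap B); apply: eq_avg => a; rewrite -avgZ.
apply: eq_avg => b; congr (_ * _).
by apply: dw => j jB; rewrite ffunE jB.
Qed.

(** The scheme of [avg_invariant_sqr_le], with conditional expectation in place of the orbit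
    average. *)
Lemma avg_depends_sqr_le Y B (v F : {ffun 'I_k -> Y} -> R) :
  depends_on B v -> bounded1 v ->
  avg (fun x => v x * F x) ^+ 2 <= avg (dbl B F).
Proof.
move=> dv v1; rewrite (avg_depends_on F dv); apply: le_trans (avg_sqr_le _) _.
apply: le_trans (_ : avg (fun x => avg_rest B F x * avg_rest B F x) <= _).
  apply: ler_avg => x; rewrite exprMn -expr2 ler_piMl ?sqr_ge0 //.
  by rewrite -real_normK ?num_real // exprn_ile1.
rewrite -avg_depends_on; last exact: depends_on_avg_rest.
by rewrite avg_dbl; apply: ler_avg => x; rewrite avgZ mulrC.
Qed.

(** Passage from bounded functions to sets. The extremal [v] is the sign of the conditional
    expectation [h], a difference of the indicators of [0 <= h] and [h < 0]. *)
Lemma avg_depends_split Y B (v F : {ffun 'I_k -> Y} -> R) :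
  depends_on B v -> bounded1 v ->
  exists2 p : bool -> pred {ffun 'I_k -> Y},
    forall s, depends_on B (fun x => (p s x)%:R)
  & `|avg (fun x => v x * F x)| <= \sum_s `|avg (fun x => (p s x)%:R * F x)|.
Proof.
move=> dv v1; pose h := avg_rest B F; have dh : depends_on B h by exact: depends_on_avg_rest.
have dp s : depends_on B (fun x => (s == (0 <= h x))%:R).
  by move=> x y /dh ->.
exists (fun s x => s == (0 <= h x)); first exact: dp.
rewrite (avg_depends_on F dv) big_bool /=.
rewrite (avg_depends_on F (dp true)) (avg_depends_on F (dp false)) -/h.
apply: le_trans (ler_norm_avg _) _.
apply: le_trans (_ : avg (fun x => (true == (0 <= h x))%:R * h x -
    (false == (0 <= h x))%:R * h x) <= _).
  apply: ler_avg => x; rewrite normrM.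
  apply: le_trans (_ : `|h x| <= _); first by rewrite ler_piMl.
  by case: ger0P => _; rewrite /= ?mul1r ?mul0r ?subr0 ?sub0r.
by rewrite avgB; apply: le_trans (ler_norm _) (ler_normB _ _).
Qed.

(* Every part is doubled, the second copies of the parts in [B] being dummies:
   this keeps all the parts of the same type. *)
Fixpoint davg (Bs : seq {set 'I_k}) Y (g : {ffun 'I_k -> Y} -> R) : R :=
  if Bs is B :: Bs' then davg Bs' (dbl B g) else avg g.

Lemma davg_bij Bs Y (Z : finType) (p : Y -> Z) (g : {ffun 'I_k -> Z} -> R) :
  bijective p ->
  davg Bs (fun y : {ffun 'I_k -> Y} => g [ffun j => p (y j)]) = davg Bs g.
Proof.
elim: Bs Y Z p g => [|B Bs IHBs] Y Z p g [q pK qK] /=.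
  apply/esym/(@avg_bij _ _ _ (fun y : {ffun 'I_k -> Y} => [ffun j => p (y j)])).
  exists (fun z : {ffun 'I_k -> Z} => [ffun j => q (z j)]) => y;
  by apply/ffunP => j; rewrite !ffunE.
rewrite -(IHBs _ _ (fun y => (p y.1, p y.2))).
  congr davg; apply: funext => z; rewrite /dbl; congr (g _ * g _).
    by apply/ffunP => j; rewrite !ffunE.
  by apply/ffunP => j; rewrite !ffunE; case: ifP.
by exists (fun z => (q z.1, q z.2)) => -[a b] /=; rewrite ?pK ?qK.
Qed.

(** Doublings commute up to relabelling, so the new doubling along [B] can be moved innermost, where
    the claim is Cauchy-Schwarz against the constant 1. *)
Lemma davg_sqr_le B Bs Y (g : {ffun 'I_k -> Y} -> R) :
  davg Bs g ^+ 2 <= davg (B :: Bs) g.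
Proof.
elim: Bs Y g => [|B' Bs IHBs] Y g /=.
  have := @avg_depends_sqr_le _ B (fun=> 1) g (fun _ _ _ => erefl).
  under eq_avg do rewrite mul1r.
  by apply=> x; rewrite normr1.
apply: le_trans (IHBs _ _) _ => /=.
(* Doubling along [B] and [B'] in either order yields a two by two array of copies; [tr] transposes
   it. *)
pose tr (q : (Y * Y) * (Y * Y)) := ((q.1.1, q.2.1), (q.1.2, q.2.2)).
rewrite -(davg_bij _ _ (p := tr)); last first.
  by apply: inv_bij => -[[]] ? ? [].
rewrite le_eqVlt; apply/orP; left; apply/eqP; congr davg.
apply: funext => z; rewrite /dbl mulrACA.
by congr (g _ * g _ * (g _ * g _)); apply/ffunP => j; rewrite !ffunE /=;
  case: (j \in B'); case: (j \in B).
Qed.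

(** Each doubling at least squares the average. This is the lower bound with respect to which a
    count is nearly minimal. *)
Lemma davg_ge Bs Y (g : {ffun 'I_k -> Y} -> R) : (forall x, 0 <= g x) ->
  avg g ^+ (2 ^ size Bs) <= davg Bs g.
Proof.
elim: Bs Y g => [|B Bs IHBs] Y g g0 /=; first by rewrite expr1.
have dg0 z : 0 <= dbl B g z by rewrite mulr_ge0.
apply: le_trans (IHBs _ _ dg0); rewrite expnS exprM lerXn2r ?nnegrE ?sqr_ge0 //.
  exact: avg_ge0.
exact: (davg_sqr_le B [::]).
Qed.

(** One factor per member of the list, in order, so that inductions peel off a factor together with
    the corresponding doubling in [davg]. *)
Fixpoint prod_along (Bs : seq {set 'I_k}) Y (U : {ffun 'I_k -> Y} -> R) : Prop :=
  if Bs is B :: Bs' then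
    exists v V, [/\ depends_on B v, bounded1 v, prod_along Bs' V
                  & U = fun x => v x * V x]
  else U = fun=> 1.

Lemma prod_along_bounded Bs Y (U : {ffun 'I_k -> Y} -> R) :
  prod_along Bs U -> bounded1 U.
Proof.
elim: Bs U => [|B Bs IHBs] U /= => [-> x|]; first by rewrite normr1.
by move=> [v [V [_ v1 /IHBs V1 ->]]] x; rewrite normrM mulr_ile1.
Qed.

Lemma prod_along_dbl B Bs Y (U : {ffun 'I_k -> Y} -> R) :
  prod_along Bs U -> prod_along Bs (dbl B U).
Proof.
elim: Bs U => [|B' Bs IHBs] U /=.
  by move=> ->; apply: funext => z; rewrite /dbl mulr1.
move=> [v [V [dv v1 /IHBs BV ->]]]; exists (dbl B v), (dbl B V); split=> //.
- move=> z z' zz'; congr (_ * _); apply: dv => j /zz' zj;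
  by rewrite !ffunE zj.
- by move=> z; rewrite normrM mulr_ile1.
- by apply: funext => z; rewrite /dbl mulrACA.
Qed.

(** Freezing [b] can only remove dependence on coordinates, so the second copy of each factor joins
    the first. *)
Lemma prod_along_sel B Bs Y (b : {ffun 'I_k -> Y}) (U : {ffun 'I_k -> Y} -> R) :
  prod_along Bs U -> prod_along Bs (fun a => U a * U (sel B a b)).
Proof.
elim: Bs U => [|B' Bs IHBs] U /=.
  by move=> ->; apply: funext => z; rewrite mulr1.
move=> [v [V [dv v1 /IHBs BV ->]]].
exists (fun a => v a * v (sel B a b)), (fun a => V a * V (sel B a b)); split=> //.
- move=> z z' zz'; congr (_ * _); apply: dv => j /zz' zj //.
  by rewrite !ffunE zj.
- by move=> z; rewrite normrM mulr_ile1.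
- by apply: funext => z; rewrite mulrACA.
Qed.

(** Superadditivity of powers, used to extract roots from inequalities with an additive error. *)
Lemma exprD_ge (a b : R) n : 0 <= a -> 0 <= b -> (0 < n)%N ->
  a ^+ n + b ^+ n <= (a + b) ^+ n.
Proof.
move=> a0 b0; case: n => // n _; elim: n => [|n IHn]; first by rewrite !expr1.
rewrite exprS [b ^+ _]exprS [leRHS]exprS.
apply: le_trans (_ : (a + b) * (a ^+ n.+1 + b ^+ n.+1) <= _).
  rewrite mulrDl !mulrDr; have := exprn_ge0 n.+1 a0; have := exprn_ge0 n.+1 b0.
  by move=> bn an; nra.
by rewrite ler_wpM2l ?addr_ge0.
Qed.

(** The factor 4 pays for a square root and for replacing [t] by its square in the induction;
    [2 ^ N'] pays for a root of that order. *)
Fixpoint dbl_exponent (N : nat) : nat :=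
  if N is N'.+1 then (4 * dbl_exponent N' * 2 ^ N')%N else 1%N.

Lemma dbl_exponent_gt0 N : (0 < dbl_exponent N)%N.
Proof. by elim: N => //= N IHN; rewrite !muln_gt0 IHN expn_gt0. Qed.

(** Induction on [Bs]. Cauchy-Schwarz removes the factor [v] along [B] and leaves the doubled
    average of [(g - del) * V]. With [g'] the second copy and [del'] the average of [g * g'], the
    product [(g - del)(g' - del)] equals [(g g' - del') - del (g - del) - del (g' - del) + (del' -
    del^2)], and each term is small against [dbl B V]. *)
Lemma davg_minimal Bs Y (y0 : Y) (g : {ffun 'I_k -> Y} -> R) t U :
  (forall x, 0 <= g x <= 1) -> 0 <= t <= 1 ->
  davg Bs g <= avg g ^+ (2 ^ size Bs) + t ^+ dbl_exponent (size Bs) ->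
  prod_along Bs U ->
  `|avg (fun x => (g x - avg g) * U x)| <= 4 * t.
Proof.
elim: Bs Y y0 g t U => [|B Bs IHBs] Y y0 g t U g01 /andP[t0 t1] /=.
  move=> _ ->; under eq_avg do rewrite mulr1.
  by rewrite avgB (avg_cst [ffun=> y0]) subrr normr0 mulr_ge0.
set N := size Bs; set M := dbl_exponent N; set del := avg g => Hmin.
move=> [v [V [dv v1 BV ->]]].
have M0 : (0 < M)%N by exact: dbl_exponent_gt0.
have del0 : 0 <= del by apply: avg_ge0 => x; case/andP: (g01 x).
have del1 : del <= 1 by apply: avg_le => // x; case/andP: (g01 x).
have V1 := prod_along_bounded BV.
pose del' := avg (dbl B g).
have del2 : del ^+ 2 <= del' by exact: (davg_sqr_le B [::]).
have dg01 z : 0 <= dbl B g z <= 1.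
  have /andP[a0 a1] := g01 (fst_ffun z); have /andP[b0 b1] := g01 (sel_ffun B z).
  by rewrite mulr_ge0 // mulr_ile1.
have texp a b : (b <= a)%N -> t ^+ a <= t ^+ b.
  by move=> ba; apply: ler_wiXn2l.
have t201 : 0 <= t ^+ 2 <= 1 by rewrite sqr_ge0 exprn_ile1.
have Npos : (0 < 2 ^ N)%N by rewrite expn_gt0.
(* The doubled function is nearly minimal for the remaining sets because [del ^+ 2 <= del']. *)
have B1 : `|avg (fun z => (dbl B g z - del') * dbl B V z)| <= 4 * t ^+ 2.
  apply: (IHBs _ (y0, y0)) => //; last exact: prod_along_dbl.
  apply: le_trans Hmin _; rewrite expnS exprM lerD //.
    by rewrite lerXn2r ?nnegrE ?sqr_ge0 // (le_trans _ del2) ?sqr_ge0.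
  by rewrite -exprM texp // -/N -/M; nia.
(* Near minimality is inherited by [g] without the doubling along [B]: take square roots in
   [davg_sqr_le]. *)
have Hg : davg Bs g <= del ^+ (2 ^ N) + (t ^+ 2) ^+ M.
  have r0 : 0 <= davg Bs g.
    apply: le_trans (davg_ge _ _); first by rewrite exprn_ge0.
    by move=> x; case/andP: (g01 x).
  have s0 : 0 <= del ^+ (2 ^ N) + t ^+ (2 * M * 2 ^ N).
    by rewrite addr_ge0 ?exprn_ge0.
  apply: le_trans (_ : del ^+ (2 ^ N) + t ^+ (2 * M * 2 ^ N) <= _); last first.
    by rewrite lerD2l -exprM texp //; nia.
  rewrite -(@ler_pXn2r _ 2) ?nnegrE //.
  apply: le_trans (davg_sqr_le B _ _) _; apply: le_trans Hmin _.
  apply: le_trans (exprD_ge _ _ _); rewrite ?exprn_ge0 //.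
  rewrite -!exprM -expnSr lerD2l le_eqVlt; apply/orP; left; apply/eqP.
  by congr (_ ^+ _); nia.
have Bg b : `|avg (fun a => (g a - del) * (V a * V (sel B a b)))| <= 4 * t ^+ 2.
  by apply: (IHBs _ y0) => //; exact: prod_along_sel.
have B2 : `|avg (fun z => (g (fst_ffun z) - del) * dbl B V z)| <= 4 * t ^+ 2.
  rewrite avg_pair_ffun exchange_avg; apply: le_trans (ler_norm_avg _) _.
  apply: avg_le => [|b]; first by rewrite mulr_ge0 ?sqr_ge0.
  apply: le_trans (Bg b); rewrite le_eqVlt; apply/orP; left; apply/eqP.
  congr `|_|; apply: eq_avg => a.
  by rewrite /dbl fst_ffun_pair sel_ffun_pair.
(* Exchanging the coordinates outside [B] swaps the two copies and reduces to the previous bound. *)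
have B3 : `|avg (fun z => (g (sel_ffun B z) - del) * dbl B V z)| <= 4 * t ^+ 2.
  rewrite avg_pair_ffun (avg_sel_swap B) exchange_avg.
  apply: le_trans (ler_norm_avg _) _.
  apply: avg_le => [|b]; first by rewrite mulr_ge0 ?sqr_ge0.
  apply: le_trans (Bg b); rewrite le_eqVlt; apply/orP; left; apply/eqP.
  congr `|_|; apply: eq_avg => a.
  rewrite /dbl fst_ffun_pair sel_ffun_pair [V a * _]mulrC.
  have -> // : sel B (sel B a b) (sel B b a) = a.
  by apply/ffunP => j; rewrite !ffunE; case: (j \in B).
(* The lower bound [davg_ge] for the doubled function leaves no room for [del'] to exceed [del ^+ 2]
   by much; superadditivity allows the root of order [2 ^ N] to be taken. *)
have B4 : `|avg (fun z => (del' - del ^+ 2) * dbl B V z)| <= t ^+ 2.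
  have dd0 : 0 <= del' - del ^+ 2 by rewrite subr_ge0.
  apply: le_trans (_ : del' - del ^+ 2 <= _).
    apply: le_trans (ler_norm_avg _) _; apply: avg_le => // z.
    rewrite normrM ger0_norm // ler_piMr // normrM mulr_ile1 //.
  apply: le_trans (_ : t ^+ (4 * M) <= _); last by apply: texp; nia.
  rewrite -(@ler_pXn2r _ (2 ^ N)) ?nnegrE ?exprn_ge0 //.
  rewrite -(lerD2r ((del ^+ 2) ^+ (2 ^ N))).
  apply: le_trans (exprD_ge _ _ _) _; rewrite ?sqr_ge0 // subrK.
  apply: le_trans (_ : davg Bs (dbl B g) <= _).
    by apply: davg_ge => z; case/andP: (dg01 z).
  by apply: le_trans Hmin _; rewrite addrC -!exprM -expnS.
rewrite -(@ler_pXn2r _ 2) ?nnegrE ?mulr_ge0 // real_normK ?num_real //.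
under eq_avg do rewrite mulrCA.
apply: le_trans (avg_depends_sqr_le _ dv v1) _.
rewrite (@eq_avg _ _ _ (fun z =>
  ((dbl B g z - del') * dbl B V z
    + (- del * ((g (fst_ffun z) - del) * dbl B V z)
       + (- del * ((g (sel_ffun B z) - del) * dbl B V z)
          + (del' - del ^+ 2) * dbl B V z))))); last first.
  by move=> z; rewrite /dbl; ring.
rewrite !avgD [avg (fun z => - del * _)]avgZ [avg (fun z => - del * _)]avgZ.
move: B1 B2 B3 B4; rewrite !ler_norml => /andP[? ?] /andP[? ?] /andP[? ?] /andP[? ?].
(* As [0 <= del <= 1], the four terms contribute at most [(4 + 4 + 4 + 1) t^2], which is below
   [(4 t)^2]. *)
have := sqr_ge0 t; nra.
Qed.

End Doubling.

(** * Iterated doublings of a Cayley hypergraph and the linear system *)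

Section DoublingClosedForm.
Variables (R : realType) (k : nat).

(** A word [w] records which copy each doubling selects. Doubling along a set containing [j] does
    not affect coordinate [j], so its bit is erased; what survives is the restriction written sigma
    with index -j in the linear system. *)
Definition msk (Bs : seq {set 'I_k}) (j : 'I_k) (w : {ffun 'I_(size Bs) -> bool}) :=
  [ffun i : 'I_(size Bs) => w i && (j \notin nth set0 Bs i)].

Lemma davg_closed Bs (Y : finType) (g : {ffun 'I_k -> Y} -> R) :
  davg Bs g =
  avg (fun x : {ffun 'I_k * {ffun 'I_(size Bs) -> bool} -> Y} =>
    \prod_w g [ffun j => x (j, msk j w)]).
Proof.
elim: Bs Y g => [|B Bs IHBs] Y g.
  have w0 (w w' : {ffun 'I_0 -> bool}) : w = w' by apply/ffunP => -[].
  rewrite [RHS](@avg_bij _ _ _ (fun y : {ffun 'I_k -> Y} =>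
    [ffun q : 'I_k * {ffun 'I_0 -> bool} => y q.1])); last first.
    exists (fun x : {ffun 'I_k * {ffun 'I_0 -> bool} -> Y} =>
      [ffun j => x (j, [ffun=> false])]) => y.
      by apply/ffunP => j; rewrite !ffunE.
    apply/ffunP => -[j w]; rewrite !ffunE; congr (y (_, _)); exact: w0.
  apply: eq_avg => y /=; rewrite (big_pred1 [ffun=> false]) => [|w].
    by congr g; apply/ffunP => j; rewrite !ffunE.
  by apply/esym/eqP/w0.
(* A pair of values is read as one value for each choice of the new first bit. *)
pose h (x : {ffun 'I_k * {ffun 'I_(size Bs) -> bool} -> Y * Y}) :=
  [ffun q : 'I_k * {ffun 'I_(size Bs).+1 -> bool} =>
    let v := x (q.1, [ffun i => q.2 (lift ord0 i)]) in
    if q.2 ord0 then v.2 else v.1].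
have hE x j b w : h x (j, fcons b w) = if b then (x (j, w)).2 else (x (j, w)).1.
  rewrite ffunE /= fcons0.
  by have -> : [ffun i => fcons b w (lift ord0 i)] = w
    by apply/ffunP => i; rewrite ffunE fconsS.
rewrite /= IHBs [RHS](@avg_bij _ _ _ h); last first.
  exists (fun x : {ffun 'I_k * {ffun 'I_(size Bs).+1 -> bool} -> Y} =>
    [ffun q => (x (q.1, fcons false q.2), x (q.1, fcons true q.2))]).
    by move=> x; apply/ffunP => -[j w]; rewrite ffunE /= !hE; case: (x _).
  move=> x; apply/ffunP => -[j w]; have [q _ qK] := fcons_bij bool (size Bs).
  by rewrite -(qK w) /= hE ffunE /=; case: (q w).1.
apply: eq_avg => x /=; rewrite [in RHS]prod_fcons big_bool /= mulrC -big_split /=.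
have mskE j b w : msk (Bs := B :: Bs) j (fcons b w) =
    fcons (b && (j \notin B)) (msk j w).
  apply/ffunP => i; rewrite !ffunE.
  by case: unliftP => [l|] -> //=; rewrite ffunE.
apply: eq_bigr => w _; rewrite /dbl; congr (g _ * g _); apply/ffunP => j;
  rewrite [RHS]ffunE mskE hE !ffunE //=.
by case: (j \in B).
Qed.

End DoublingClosedForm.

Lemma prod_bool (R : comPzRingType) (I : finType) (b : pred I) :
  \prod_i (b i)%:R = [forall i, b i]%:R :> R.
Proof.
case: (boolP [forall i, b i]) => [/forallP bT|].
  by rewrite big1 // => i _; rewrite bT.
rewrite negb_forall => /existsP[i /negbTE bi].
by rewrite (bigD1 i) //= bi mul0r.
Qed.

Lemma card_dsets k d : #|{: dsets k d}| = 'C(k, d).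
Proof.
by rewrite card_sig -[in RHS](card_ord k) -card_draws; apply: eq_card => B;
  rewrite !inE.
Qed.

Definition dset_seq k d : seq {set 'I_k} := [seq val B | B <- enum {: dsets k d}].

Lemma size_dset_seq k d : size (dset_seq k d) = 'C(k, d).
Proof. by rewrite size_map -cardE card_dsets. Qed.

Lemma davg_cayley (R : realType) (G : finZmodType) k d (A : {set G}) :
  davg (dset_seq k d) (@cayley R G k A) =
  avg (fun x : {ffun Jkd k d -> G} =>
         [forall s : {ffun dsets k d -> bool}, phi s x \in A]%:R).
Proof.
set Bs := dset_seq k d.
have sE : #|{: dsets k d}| = size Bs by rewrite size_map -cardE.
pose bi (i : 'I_(size Bs)) : dsets k d := enum_val (cast_ord (esym sE) i).
pose rk (B : dsets k d) : 'I_(size Bs) := cast_ord sE (enum_rank B).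
have biK : cancel rk bi by move=> B; rewrite /bi cast_ordK enum_rankK.
have rkK : cancel bi rk by move=> i; rewrite /rk enum_valK cast_ordKV.
have nthE i : nth set0 Bs (nat_of_ord i) = val (bi i).
  rewrite (nth_map (bi i)); last by rewrite -cardE sE.
  by congr val; apply/esym/(enum_val_nth (bi i)).
(* Each variable of the system corresponds to a masked word, with [false] at the sets that contain
   its coordinate. *)
pose io (q : Jkd k d) : 'I_k * {ffun 'I_(size Bs) -> bool} :=
  (tag q, [ffun i => oapp (tagged q) false (insub (val (bi i)))]).
pose p (x : {ffun 'I_k * {ffun 'I_(size Bs) -> bool} -> G})
  : {ffun Jkd k d -> G} := [ffun q => x (io q)].
(* A section of [p], so [p] preserves averages and the entries at unmasked words are dummies. *)
pose e (z : {ffun Jkd k d -> G})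
  : {ffun 'I_k * {ffun 'I_(size Bs) -> bool} -> G} :=
  [ffun q : 'I_k * {ffun 'I_(size Bs) -> bool} =>
     z (Tagged (fun j => {ffun dsets_out d j -> bool})
       [ffun B : dsets_out d q.1 => q.2 (rk (exist _ (val B) (dsets_out_card B)))])].
have pe x z : p (x + e z) = p x + z.
  apply/ffunP => -[j t]; rewrite !ffunE; congr (_ + z _).
  rewrite /io /=; congr existT; apply/ffunP => B.
  by rewrite !ffunE biK /= valK.
rewrite davg_closed.
rewrite -(avg_proj (fun x : {ffun Jkd k d -> G} =>
  [forall s : {ffun dsets k d -> bool}, phi s x \in A]%:R) pe).
apply: eq_avg => x; rewrite -prod_bool.
rewrite (reindex (fun s : {ffun dsets k d -> bool} => [ffun i => s (bi i)])) /=.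
  apply: eq_bigr => s _; rewrite /cayley; congr (nat_of_bool (_ \in A))%:R.
  apply: eq_bigr => j _; rewrite !ffunE; congr (x (_, _)).
  apply/ffunP => i; rewrite !ffunE nthE.
  case: insubP => [B /andP[_ /= jB] BE|/=].
    by rewrite jB andbT ffunE; congr (s _); apply: val_inj; rewrite /= BE.
  by rewrite (valP (bi i)) /= => /negbNE ->; rewrite andbF.
apply: onW_bij; exists (fun w : {ffun 'I_(size Bs) -> bool} => [ffun B => w (rk B)]).
  by move=> s; apply/ffunP => B; rewrite !ffunE biK.
by move=> w; apply/ffunP => i; rewrite !ffunE rkK.
Qed.

(** * From functions of [d] coordinates to the uniformity norm *)

Section CutToGowers.
Variables (R : realType) (G : finZmodType) (k d : nat) (f : G -> R).
Hypotheses (f1 : bounded1 f) (hk : (d < k)%N).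
Implicit Types (I J : {set 'I_k}) (D : {set {set 'I_k}}).
Implicit Types (U u v : {ffun 'I_k -> G} -> R).

Definition fam D J := (#|J| <= d)%N || (J \in D).
Definition along D u := exists2 J, fam D J & depends_on J u.

Lemma bprod_split D I U : bprod (along D) U ->
  exists v V, [/\ depends_on I v, bounded1 v, bprod (along (D :\ I)) V
                & forall x, U x = v x * V x].
Proof.
elim=> [|u W [J DJ du] u1 _ [v [V [dv v1 DV WE]]]].
  exists (fun=> 1), (fun=> 1); split=> //; last by move=> x; rewrite mulr1.
    by move=> x; rewrite normr1.
  exact: bprod1.
have [JI|JI] := eqVneq J I.
  exists (fun x => u x * v x), V; split=> //.
  - by apply: depends_onM => //; rewrite -JI.
  - by move=> x; rewrite normrM mulr_ile1.
  - by move=> x; rewrite WE mulrA.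
exists v, (fun x => u x * V x); split=> //; last by move=> x; rewrite WE mulrCA.
by apply: bprodS => //; exists J => //; rewrite /fam !inE JI.
Qed.

(* The second copy of [x] agrees with [x] on [I] and is fresh outside [I], up to
   a translation of the coordinate [j0] that cancels [x i0] in the total sum. *)
Section Elimination.
Variables (I : {set 'I_k}) (i0 j0 : 'I_k).
Hypotheses (i0I : i0 \in I) (j0I : j0 \notin I).

Definition copy (x t : {ffun 'I_k -> G}) : {ffun 'I_k -> G} :=
  [ffun j => if j \in I then x j else t j - (if j == j0 then x i0 else 0)].

(** The coordinates of [x] visible in the copy through [J]: reading [j0] outside [I] reveals
    [x i0]. *)
Definition seen J := (J :&: I) :|: (if j0 \in J then [set i0] else set0).

Lemma avg_copy_sqr_le v V : depends_on I v -> bounded1 v ->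
  avg (fun x : {ffun 'I_k -> G} => f (\sum_j x j) * (v x * V x)) ^+ 2 <=
  avg (fun t => avg (fun x : {ffun 'I_k -> G} => f (\sum_j x j) *
    (V x * (f (\sum_j copy x t j) * V (copy x t))))).
Proof.
move=> dv v1.
pose e (y : {ffun 'I_k -> G}) : {ffun 'I_k -> G} :=
  [ffun j => if j \in I then 0 else y j].
have eD s t : e (s + t) = e s + e t.
  by apply/ffunP => j; rewrite !ffunE; case: ifP; rewrite ?addr0.
have ve x t : v (x + e t) = v x.
  by apply: dv => j jI; rewrite !ffunE jI addr0.
under eq_avg do rewrite mulrCA.
pose F (x : {ffun 'I_k -> G}) := f (\sum_j x j) * V x.
apply: le_trans (avg_invariant_sqr_le F eD ve v1) _.
rewrite exchange_avg [leRHS]exchange_avg; apply: ler_avg => x.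
(* Recentring [t] makes the coordinates outside [I] fresh, apart from the correction at [j0]. *)
rewrite (avg_shift [ffun j => - x j - (if j == j0 then x i0 else 0)]).
apply: ler_avg => t.
have -> : x + e (t + [ffun j => - x j - (if j == j0 then x i0 else 0)]) = copy x t.
  apply/ffunP => j; rewrite !ffunE; case: ifP => _; first by rewrite addr0.
  by rewrite addrCA addNKr.
by rewrite /F !mulrA.
Qed.

(** In the total sum [x i0] occurs once at [i0] and once, with the opposite sign, at [j0]. The new
    factor thus lives on a proper subset of [I]. *)
Lemma depends_on_sum_copy t :
  depends_on (I :\ i0) (fun x => f (\sum_j copy x t j)).
Proof.
have j0i0 : j0 != i0 by apply: contraNneq j0I => ->.
move=> x y xy; congr f.
rewrite (bigD1 i0) //= (bigD1 j0) //= [RHS](bigD1 i0) //= [in RHS](bigD1 j0) //=.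
rewrite !addrA; congr (_ + _).
  rewrite !ffunE i0I (negbTE j0I) eqxx.
  by rewrite ![_ + (t j0 - _)]addrC !subrK.
apply: eq_bigr => j /andP[ji0 jj0]; rewrite !ffunE (negbTE jj0).
by case: ifP => // jI; rewrite xy // !inE ji0.
Qed.

Lemma depends_on_copy J t u :
  depends_on J u -> depends_on (seen J) (fun x => u (copy x t)).
Proof.
move=> du x y xy; apply: du => j jJ; rewrite !ffunE; case: ifP => jI.
  by rewrite xy // !inE jJ jI.
case: eqP => // jj0; rewrite (xy i0) // !inE.
by rewrite -jj0 jJ inE eqxx orbT.
Qed.

Lemma bprod_copy D t V :
  (forall J, fam (D :\ I) J -> fam (D :\ I) (seen J)) ->
  bprod (along (D :\ I)) V -> bprod (along (D :\ I)) (fun x => V (copy x t)).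
Proof.
move=> Dseen; elim=> [|u W [J DJ du] u1 _ IH]; first exact: bprod1.
apply: (bprodS (u := fun x => u (copy x t)) (U := fun x => W (copy x t))) => //.
by exists (seen J); [exact: Dseen | exact: depends_on_copy].
Qed.

End Elimination.

Variable b : 'I_k -> 'I_d.+1.
Hypothesis b_onto : forall i, exists j, b j = i.

(** Lexicographic order by the number of blocks met and then by size, since a size is at most
    [k]. *)
Definition key I := (#|b @: I| * k.+1 + #|I|)%N.

Lemma key_proper I J : J \proper I -> (key J < key I)%N.
Proof.
move=> JI; rewrite /key -addnS leq_add ?proper_card // leq_mul2r.
by rewrite subset_leq_card ?orbT // imsetS // proper_sub.
Qed.

Variable c : R.
Hypothesis cut_le : forall U, bprod (along set0) U ->
  `|avg (fun x : {ffun 'I_k -> G} => f (\sum_j x j) * U x)| <= c.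

(* A set [I] of maximal key is eliminated by one Cauchy-Schwarz step.  Since [I]
   has more than [d] elements but meets at most [d] blocks, there are [i0] in [I]
   whose block meets [I] again and [j0] in a block that misses [I]; the sets that
   could see all of [I] through the copy have a larger key. *)
Lemma cut_elimination D U :
  (forall I J, I \in D -> J \proper I -> fam D J) ->
  (forall I, I \in D -> (d < #|I|)%N /\ (#|b @: I| <= d)%N) ->
  bprod (along D) U ->
  `|avg (fun x : {ffun 'I_k -> G} => f (\sum_j x j) * U x)| ^+ (2 ^ #|D|) <= c.
Proof.
move: {2}#|D| (erefl #|D|) => n; elim: n D U => [|n IHn] D U cardD Dcl Dbad PU.
  rewrite cardD expr1; apply: cut_le.
  by rewrite (cards0_eq cardD) in PU.
have [I1 I1D] : exists I1, I1 \in D by apply/card_gt0P; rewrite cardD.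
have [I ID Imax] : exists2 I, I \in D & forall J, J \in D -> (key J <= key I)%N.
  by case: (arg_maxnP key I1D) => I ID Imax; exists I.
have [dI hI] := Dbad I ID.
have cardDI : #|D :\ I| = n by move: cardD; rewrite (cardsD1 I) ID => -[].
have DIcl I' J : I' \in D :\ I -> J \proper I' -> fam (D :\ I) J.
  rewrite !inE => /andP[_ I'D] JI'; have /orP[Jd|JD] := Dcl _ _ I'D JI'.
    by rewrite /fam Jd.
  rewrite /fam !inE JD andbT; apply/orP; right.
  have := leq_trans (key_proper JI') (Imax I' I'D).
  by apply: contraTneq => ->; rewrite ltnn.
have Icl J : J \proper I -> fam (D :\ I) J.
  move=> JI; have := Dcl _ _ ID JI; rewrite /fam !inE.
  by move: (JI); rewrite properEneq => /andP[-> _].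
have [i0 i0I [i1 i1I [i01 bi01]]] : exists2 i0, i0 \in I &
    exists2 i1, i1 \in I & i0 != i1 /\ b i0 = b i1.
  have : ~~ [forall i0 in I, forall i1 in I, (b i0 == b i1) ==> (i0 == i1)].
    apply: contraL (leq_ltn_trans hI dI) => /forall_inP binj.
    rewrite -leqNgt card_in_imset // => i j iI jI /eqP bij.
    by apply/eqP; have /forall_inP/(_ j jI)/implyP := binj i iI; apply.
  rewrite negb_forall_in => /exists_inP[i0 i0I].
  rewrite negb_forall_in => /exists_inP[i1 i1I].
  rewrite negb_imply => /andP[/eqP bij ij].
  by exists i0 => //; exists i1.
have [j0 j0I] : exists j0, b j0 \notin b @: I.
  have : ~~ ([set: 'I_d.+1] \subset b @: I).
    apply/negP => /subset_leq_card; rewrite cardsT card_ord => dh.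
    by have := leq_trans dh hI; rewrite ltnn.
  case/subsetPn => i _ ih; have [j bj] := b_onto i.
  by exists j; rewrite bj.
have j0I' : j0 \notin I by apply: contra j0I => ?; apply: imset_f.
have Dseen J : fam (D :\ I) J -> fam (D :\ I) (seen I i0 j0 J).
  move=> DJ; apply: Icl; rewrite properE; apply/andP; split.
    rewrite /seen subUset subsetIr; case: ifP; rewrite ?sub0set //.
    by rewrite sub1set.
  apply/negP => Iseen.
  (* If the copy saw all of [I] through [J], then [J] would contain every element of [I] except
     possibly [i0]. *)
  have IJ : I :\ i0 \subset J.
    apply/subsetP => i; rewrite !inE => /andP[ii0 /(subsetP Iseen)].
    by rewrite !inE; case: ifP; rewrite !inE ?(negbTE ii0) ?orbF => _ /andP[].
  have badJ : (#|I| <= #|J|)%N -> (key J <= key I)%N /\ J != I.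
    move=> leIJ; move: DJ; rewrite /fam leqNgt (leq_trans dI leIJ) /= !inE.
    by move=> /andP[-> /Imax].
  (* If [J] contains [j0], it meets the new block of [j0] and, thanks to [i1], every block of [I];
     otherwise it strictly contains [I]. Either way its key is too large. *)
  have [j0J|j0J] := boolP (j0 \in J).
    have subJ : j0 |: (I :\ i0) \subset J by rewrite subUset sub1set j0J.
    have cJ : (#|I| <= #|J|)%N.
      apply: leq_trans (subset_leq_card subJ).
      by rewrite cardsU1 !inE (negbTE j0I') andbF (cardsD1 i0 I) i0I.
    have [+ _] := badJ cJ.
    suff : (#|b @: I| < #|b @: J|)%N.
      by have := max_card (mem I); rewrite card_ord /key; nia.
    apply: leq_trans (subset_leq_card (imsetS b subJ)).
    apply: leq_trans (_ : #|b j0 |: (b @: I)| <= _)%N.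
      by rewrite cardsU1 j0I.
    apply: subset_leq_card; rewrite imsetU1 setUS //.
    apply/subsetP => _ /imsetP[i iI ->].
    have [->|ii0] := eqVneq i i0; last by apply: imset_f; rewrite !inE ii0.
    by rewrite bi01; apply: imset_f; rewrite !inE eq_sym i01.
  have IsJ : I \subset J.
    by apply: subset_trans Iseen _; rewrite /seen (negbTE j0J) setU0 subsetIl.
  have [+ JI] := badJ (subset_leq_card IsJ).
  suff : (key I < key J)%N by rewrite ltnNge => /negbTE ->.
  by apply: key_proper; rewrite properEneq eq_sym JI.
have [v [V [dv v1 PV UE]]] := bprod_split I PU.
rewrite cardD expnS exprM real_normK ?num_real //.
under eq_avg do rewrite UE.
pose a t := avg (fun x : {ffun 'I_k -> G} => f (\sum_j x j) *
    (V x * (f (\sum_j copy I i0 j0 x t j) * V (copy I i0 j0 x t)))).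
apply: le_trans (_ : avg (fun t => `|a t|) ^+ (2 ^ n) <= _).
  apply: lerXn2r; rewrite ?nnegrE ?sqr_ge0 //.
    by apply: avg_ge0 => t; exact: normr_ge0.
  apply: le_trans (avg_copy_sqr_le i0 j0 V dv v1) _.
  by apply: ler_avg => t; exact: ler_norm.
apply: le_trans (avg_expn2_le _ _) _.
have c0 : 0 <= c by apply: le_trans (cut_le (bprod1 _)); exact: normr_ge0.
apply: avg_le => // t; rewrite -cardDI; apply: IHn => //.
  by move=> I' /setD1P[_]; exact: Dbad.
apply: bprodM => //; apply: bprodM; last exact: bprod_copy.
apply: bprod_base => [|x]; last exact: f1.
exists (I :\ i0); last exact: depends_on_sum_copy.
by apply: Icl; rewrite properD1.
Qed.

(** The base point of the cube is written as the sum of all [x j], and each direction [h i] is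
    shifted by minus the sum over block [i]. The vertex [w] then no longer sees the blocks [i] with
    [w i]. *)
Lemma gavg_blocks : gavg d.+1 f =
  avg (fun h : {ffun 'I_d.+1 -> G} => avg (fun x : {ffun 'I_k -> G} =>
    f (\sum_j x j) * \prod_(w : {ffun 'I_d.+1 -> bool} | w != [ffun=> false])
      f (\sum_(j | ~~ w (b j)) x j + \sum_(i | w i) h i))).
Proof.
pose j0 := Ordinal (leq_ltn_trans (leq0n d) hk).
pose p (x : {ffun 'I_k -> G}) := \sum_j x j.
pose e (t : G) : {ffun 'I_k -> G} := [ffun j => if j == j0 then t else 0].
have pe x t : p (x + e t) = p x + t.
  rewrite /p; under eq_bigr do rewrite ffunE; rewrite big_split; congr (_ + _).
  rewrite (bigD1 j0) //= ffunE eqxx big1 ?addr0 // => j /negbTE jj0.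
  by rewrite ffunE jj0.
rewrite [LHS]/gavg -(avg_proj _ pe) exchange_avg [RHS]exchange_avg.
rewrite exchange_avg; apply: eq_avg => x.
rewrite (avg_shift [ffun i => - \sum_(j | b j == i) x j]); apply: eq_avg => h.
have sumE (w : {ffun 'I_d.+1 -> bool}) : p x +
    \sum_(i | w i) (h + [ffun i => - \sum_(j | b j == i) x j] : {ffun _ -> _}) i =
    \sum_(j | ~~ w (b j)) x j + \sum_(i | w i) h i.
  under eq_bigr do rewrite !ffunE; rewrite big_split /= sumrN.
  have -> : \sum_(i | w i) \sum_(j | b j == i) x j = \sum_(j | w (b j)) x j.
    rewrite [RHS](partition_big b w) //; apply: eq_bigr => i wi.
    by apply: eq_bigl => j; case: eqP => [->|]; rewrite ?wi ?andbF.
  rewrite /p (bigID (fun j => w (b j))) /= [X in X + _]addrC.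
  by rewrite [X in _ + X]addrC addrA addrK.
rewrite (bigD1 [ffun=> false]) //= sumE; congr (f _ * _).
  rewrite [X in _ + X]big_pred0 ?addr0 => [|i]; last by rewrite ffunE.
  by apply: eq_bigl => j; rewrite ffunE.
by apply: eq_bigr => w _; rewrite sumE.
Qed.

(** For fixed [h], each vertex other than the zero one gives a factor missing a block. The large
    sets that miss a block are closed under proper subsets up to small sets, so [cut_elimination]
    applies. *)
Lemma cut_gavg_le :
  gavg d.+1 f ^+ (2 ^ #|[set I : {set 'I_k} | (d < #|I|)%N & (#|b @: I| <= d)%N]|) <= c.
Proof.
set D := [set I | _ & _]; set n := #|D|.
have c0 : 0 <= c by apply: le_trans (cut_le (bprod1 _)); exact: normr_ge0.
rewrite gavg_blocks; set a := fun h : {ffun 'I_d.+1 -> G} => avg _.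
have g0 : 0 <= avg a by rewrite -gavg_blocks gavg_ge0.
apply: le_trans (_ : avg (fun h => `|a h|) ^+ (2 ^ n) <= _).
  apply: lerXn2r; rewrite ?nnegrE //.
    by apply: avg_ge0 => h; exact: normr_ge0.
  by apply: ler_avg => h; exact: ler_norm.
apply: le_trans (avg_expn2_le _ _) _.
have Dfam J : (#|b @: J| <= d)%N -> fam D J.
  by rewrite /fam !inE => ->; rewrite andbT; case: leqP.
apply: avg_le => // h; apply: cut_elimination.
- move=> I J; rewrite inE => /andP[_ hI] /proper_sub/(imsetS b)/subset_leq_card JI.
  exact/Dfam/(leq_trans JI).
- by move=> I; rewrite inE => /andP[].
apply: bprod_prod => w _ w0; apply: bprod_base => [|x]; last exact: f1.
exists [set j | ~~ w (b j)]; last first.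
  move=> x y xy; congr (f (_ + _)); apply: eq_bigr => j wj.
  by rewrite xy // inE.
have [i wi] : exists i, w i.
  apply/existsP; apply: contraNT w0; rewrite negb_exists => /forallP w0.
  by apply/eqP/ffunP => i; rewrite ffunE; apply/negbTE.
apply: Dfam; rewrite -ltnS -[X in (_ < X)%N]card_ord -cardsT.
apply: proper_card; apply/properP; split; first exact: subsetT.
exists i; rewrite ?inE //; apply/imsetP => -[j]; rewrite inE => /negP wj ij.
by apply: wj; rewrite -ij.
Qed.

End CutToGowers.

Lemma cut_gowers_le (R : realType) (k d : nat) : (d < k)%N ->
  exists2 n : nat, (0 < n)%N &
  forall (G : finZmodType) (f : G -> R) (c : R), bounded1 f ->
    (forall v : dsets k d -> {ffun 'I_k -> G} -> R,
       (forall B, depends_on (val B) (v B) /\ bounded1 (v B)) ->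
       `|avg (fun x : {ffun 'I_k -> G} => f (\sum_j x j) * \prod_B v B x)| <= c) ->
    gowers d.+1 f ^+ n <= c.
Proof.
move=> hk; pose b (j : 'I_k) : 'I_d.+1 := inord (minn j d).
have b_onto i : exists j, b j = i.
  exists (widen_ord hk i); apply: val_inj.
  by rewrite /b /= inordK ?(minn_idPl _) ?ltnS ?geq_minr -1?ltnS.
exists (2 ^ d.+1 * 2 ^ #|[set I : {set 'I_k} | (d < #|I|)%N & (#|b @: I| <= d)%N]|)%N.
  by rewrite muln_gt0 !expn_gt0.
move=> G f c f1 cut_le; rewrite exprM gowersX.
apply: cut_gavg_le => // U PU.
have [|||v vP UE] := @bprod_collect _ _ (dsets k d)
  (fun B u => depends_on (val B) u) U.
- by [].
- by move=> B u v; exact: depends_onM.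
- apply: bprod_sub PU => u [J]; rewrite /fam inE orbF => Jd du.
  (* Sets with fewer than [d] elements are enlarged to [d]-sets, which exist because [d < k]. *)
  suff [B JB Bd] : exists2 B : {set 'I_k}, J \subset B & #|B| == d.
    by exists (exist _ B Bd); exact: depends_onS du.
  have [m] := ubnP (d - #|J|); elim: m J Jd {du} => // m IHm J Jd Jm.
  have [JE|Jd'] := eqVneq #|J| d; first by exists J => //; rewrite JE.
  have [j jJ] : exists j, j \notin J.
    have : ~~ ([set: 'I_k] \subset J).
      apply/negP => /subset_leq_card; rewrite cardsT card_ord => kJ.
      by have := leq_trans hk (leq_trans kJ Jd); rewrite ltnn.
    by case/subsetPn => j _; exists j.
  have [||B] := IHm (j |: J); rewrite ?cardsU1 ?jJ; [lia | lia |].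
  by move=> JB Bd; exists B => //; apply: subset_trans JB; exact: subsetUr.
by under eq_avg do rewrite UE; exact: cut_le.
Qed.

(** * Consequences of small uniformity norm *)

Lemma subset_of_card (T : finType) (A : {set T}) m : (m <= #|A|)%N ->
  exists2 S : {set T}, S \subset A & #|S| = m.
Proof.
move=> mA; exists [set x in take m (enum A)].
  by apply/subsetP => x; rewrite inE => /mem_take; rewrite mem_enum.
rewrite cardsE (card_uniqP _) ?size_takel -?cardE //.
by rewrite take_uniq // enum_uniq.
Qed.

Section Balanced.
Variables (R : realType) (G : finZmodType) (A : {set G}).

Definition balanced (x : G) : R := (x \in A)%:R - density R A.

Lemma density01 : 0 <= density R A <= 1.
Proof.
have G0 : 0 < #|G|%:R :> R by rewrite ltr0n; apply/card_gt0P; exists 0.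
by rewrite divr_ge0 ?ler0n //= ler_pdivrMr // mul1r ler_nat max_card.
Qed.

Lemma balanced_bounded : bounded1 balanced.
Proof.
move=> x; have /andP[d0 d1] := density01; rewrite /balanced ler_norml.
by case: (x \in A) => /=; apply/andP; split; lra.
Qed.

Lemma avg_mem : avg (fun x => (x \in A)%:R) = density R A.
Proof.
rewrite /avg /density; congr (_ / _).
by rewrite -natr_sum -big_mkcond sum1_card.
Qed.

Lemma sum_single_coord n (e : {set 'I_n}) v (x : {ffun 'I_n -> G}) (t : G) :
  v \in e ->
  \sum_(i in e) (x + [ffun i => if i == v then t else 0]) i = \sum_(i in e) x i + t.
Proof.
move=> ve; under eq_bigr do rewrite ffunE; rewrite big_split /=; congr (_ + _).
rewrite (bigD1 v) //= ffunE eqxx big1 ?addr0 // => i /andP[_ /negbTE iv].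
by rewrite ffunE iv.
Qed.

Lemma sum_setT n (x : 'I_n -> G) : \sum_(i in [set: 'I_n]) x i = \sum_i x i.
Proof. by apply: eq_bigl => i; rewrite inE. Qed.

Lemma avg_cayley k : (0 < k)%N -> avg (@cayley R G k A) = density R A.
Proof.
move=> k0; rewrite -avg_mem.
rewrite -(avg_proj (p := fun x : {ffun 'I_k -> G} => \sum_i x i)
  (e := fun t => [ffun i => if i == Ordinal k0 then t else 0])) //.
by move=> x t; rewrite -!sum_setT sum_single_coord ?inE.
Qed.

(** The directions are the single coordinates in [S]: each translates the sum over [e], and each
    factor of [U] ignores one of them. *)
Lemma von_neumann_coord n d (e S : {set 'I_n}) (U : {ffun 'I_n -> G} -> R) :
  S \subset e -> #|S| = d.+1 ->
  bprod (fun u => exists2 v, v \in S & depends_on (~: [set v]) u) U ->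
  `|avg (fun x : {ffun 'I_n -> G} => balanced (\sum_(v in e) x v) * U x)|
    <= gowers d.+1 balanced.
Proof.
move=> Se cardS PU.
rewrite -(@ler_pXn2r _ (2 ^ d.+1)) ?expn_gt0 ?nnegrE ?powR_ge0 // gowersX.
pose s (i : 'I_d.+1) : 'I_n := enum_val (cast_ord (esym cardS) i).
have sS i : s i \in S by exact: enum_valP.
apply: (@von_neumann_bprod R G d balanced {ffun 'I_n -> G}
  (fun x => \sum_(v in e) x v)
  (fun i t => [ffun v => if v == s i then t else 0])).
- by move=> i x y; apply/ffunP => v; rewrite !ffunE; case: ifP; rewrite ?addr0.
- by move=> i x t; rewrite sum_single_coord // (subsetP Se).
apply: bprod_sub PU => u [v vS du].
exists (cast_ord cardS (enum_rank_in vS v)) => x t; apply: du => w.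
rewrite !inE !ffunE /s cast_ordK enum_rankK_in // => /negbTE ->.
by rewrite addr0.
Qed.

(** The sum forgets the order in which [edge_tuple] lists the vertices, and [#|e| = k] keeps its
    default value 0 out of reach. *)
Lemma cayley_edge k n (x : {ffun 'I_n -> G}) (e : {set 'I_n}) : #|e| = k ->
  cayley R A (edge_tuple k x e) = ((\sum_(v in e) x v) \in A)%:R.
Proof.
move=> ek; rewrite /cayley; congr (nat_of_bool (_ \in A))%:R.
transitivity (\sum_(y <- [seq x v | v <- enum e]) y).
  rewrite (big_nth 0) size_map -cardE ek big_mkord.
  by apply: eq_bigr => i _; rewrite ffunE.
by rewrite big_map big_enum.
Qed.

(** A [d]-set always misses an element of a fixed set [T] of [d + 1] coordinates. *)
Lemma gowers_cutnorm_le k d : (d < k)%N ->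
  cutnorm d (fun x => @cayley R G k A x - density R A) <= gowers d.+1 balanced.
Proof.
move=> hk; apply: bigmax_le => [|S _]; first exact: powR_ge0.
have [|T _ cardT] := @subset_of_card _ [set: 'I_k] d.+1.
  by rewrite cardsT card_ord.
apply: le_trans (@von_neumann_coord _ _ _ T
  (fun x => \prod_(B : dsets k d) (restrx (val B) x \in S B)%:R)
  (subsetT T) cardT _).
  rewrite le_eqVlt; apply/orP; left; apply/eqP; congr `|_|.
  by apply: eq_avg => x; rewrite /balanced /cayley sum_setT.
apply: bprod_prod => B _ _; apply: bprod_base; last first.
  by move=> x; rewrite ger0_norm ?ler0n // lern1 leq_b1.
have [v vT vB] : exists2 v, v \in T & v \notin val B.
  apply/subsetPn/negP => /subset_leq_card.
  by rewrite cardT (eqP (valP B)) ltnn.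
exists v => // x y xy; congr (nat_of_bool (_ \in S B))%:R.
apply/ffunP => -[i iB]; rewrite !ffunE /=; apply: xy.
by rewrite !inE; apply: contraNneq vB => <-.
Qed.

(** Edges are replaced by the density one at a time. Each replacement costs one norm, since every
    other edge misses a vertex of the private set [S] of the current one. *)
Lemma gowers_hom_density_le k d n (E : {set {set 'I_n}}) :
  kgraph k E -> ssimple d.+1 E ->
  `|hom_density E (@cayley R G k A) - density R A ^+ #|E| |
    <= #|E|%:R * gowers d.+1 balanced.
Proof.
move=> /forall_inP Ek /forall_inP Es.
pose a (e : {set 'I_n}) (x : {ffun 'I_n -> G}) : R := ((\sum_(v in e) x v) \in A)%:R.
have -> : hom_density E (@cayley R G k A) =
    avg (fun x => \prod_(e <- enum E) a e x).
  apply: eq_avg => x; rewrite big_enum; apply: eq_bigr => e eE.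
  by rewrite cayley_edge // (eqP (Ek e eE)).
rewrite cardE; have : {subset enum E <= E} by move=> e; rewrite mem_enum.
elim: (enum E) (enum_uniq (mem E)) => [|e s IHs] /= => [_ _|/andP[es us] sE].
  by under eq_avg do rewrite big_nil; rewrite (avg_cst 0) subrr normr0 mul0r.
have eE : e \in E by apply: sE; rewrite mem_head.
have {}IHs := IHs us (fun e' e's => sE e' (mem_behead (s := e :: s) e's)).
have /existsP[S /and3P[Se /eqP cardS /forall_inP S1]] := Es e eE.
rewrite (@eq_avg _ _ _ (fun x : {ffun 'I_n -> G} => balanced (\sum_(v in e) x v) *
  \prod_(e' <- s) a e' x + density R A * \prod_(e' <- s) a e' x)); last first.
  by move=> x; rewrite big_cons -mulrDl subrK.
rewrite avgD avgZ exprS -addrA -mulrBr.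
apply: le_trans (ler_normD _ _) _; rewrite -natr1 mulrDl mul1r addrC.
have /andP[d0 d1] := density01; apply: lerD.
  by rewrite normrM (ger0_norm d0); apply: le_trans IHs; rewrite ler_piMl.
apply: von_neumann_coord Se cardS _.
apply: bprod_prod => e' e's _; apply: bprod_base; last first.
  by move=> x; rewrite ger0_norm ?ler0n // lern1 leq_b1.
have e'E : e' \in E by apply: sE; rewrite in_cons e's orbT.
have /subsetPn[v vS ve'] : ~~ (S \subset e').
  by apply: (implyP (S1 e' e'E)); apply: contraNneq es => <-.
exists v => // x y xy; rewrite /a; congr (nat_of_bool (_ \in A))%:R.
apply: eq_bigr => w we'; apply: xy; rewrite !inE.
by apply: contraNneq ve' => <-.
Qed.

End Balanced.

Lemma dlinear_ssimple k d n (E : {set {set 'I_n}}) : (d < k)%N ->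
  kgraph k E -> dlinear d E -> ssimple d.+1 E.
Proof.
move=> hk /forall_inP Ek /forall_inP Ed; apply/forall_inP => e eE.
have [|S Se cardS] := @subset_of_card _ e d.+1; first by rewrite (eqP (Ek e eE)).
apply/existsP; exists S; rewrite Se cardS eqxx /=.
apply/forall_inP => e' e'E; apply/implyP => ee'; apply/negP => Se'.
have /forall_inP/(_ e' e'E)/implyP := Ed e eE; rewrite eq_sym => /(_ ee').
by rewrite leqNgt -cardS subset_leq_card // subsetI Se.
Qed.

(** * Deviation and cut norm *)

Lemma avg_tuple (R : realType) (T : finType) n (F : n.-tuple T -> R) :
  avg F = avg (fun x : {ffun 'I_n -> T} => F [tuple x i | i < n]).
Proof.
apply: avg_bij; exists (fun t : n.-tuple T => [ffun i => tnth t i]) => [x|t].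
  by apply/ffunP => i; rewrite ffunE tnth_mktuple.
by apply: eq_from_tnth => i; rewrite tnth_mktuple ffunE.
Qed.

(** With [x1 - x0] as the directions, the coordinates of [x0] and [y] enter only through their sum,
    which is a uniformly distributed base point. *)
Lemma dev_gavg (R : realType) (G : finZmodType) k d (A : {set G}) : (d < k)%N ->
  dev d (@cayley R G k A) (density R A) = gavg d.+1 (balanced R A).
Proof.
move=> hk.
pose th (s : G) := avg (fun h : {ffun 'I_d.+1 -> G} =>
  \prod_(w : {ffun 'I_d.+1 -> bool}) balanced R A (s + \sum_(i < d.+1 | w i) h i)).
have sumE (x0 x1 : {ffun 'I_d.+1 -> G}) (y : {ffun 'I_(k - d.+1) -> G})
    (w : {ffun 'I_d.+1 -> bool}) :
  \sum_(i < k) [ffun i : 'I_k => if (i < d.+1)%N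
    then nth 0 (if w (inord i) then [tuple x1 i | i < d.+1]
                else [tuple x0 i | i < d.+1]) i
    else nth 0 [tuple y i | i < k - d.+1] (i - d.+1)] i =
  \sum_i x0 i + \sum_i y i + \sum_(i | w i) (x1 - x0) i.
  under eq_bigr do rewrite ffunE.
  rewrite -(big_mkord xpredT (fun i => if (i < d.+1)%N
    then nth 0 (if w (inord i) then [tuple x1 i | i < d.+1]
                else [tuple x0 i | i < d.+1]) i
    else nth 0 [tuple y i | i < k - d.+1] (i - d.+1))) /=.
  rewrite (big_cat_nat (n := d.+1)) //= -[X in \sum_(X <= _ < k) _]add0n big_addn.
  rewrite !big_mkord [RHS]addrAC; congr (_ + _).
    rewrite [X in _ + X]big_mkcond -big_split /=; apply: eq_bigr => i _.
    rewrite ltn_ord inord_val !ffunE.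
    by case: ifP => _; rewrite nth_mktuple ?addr0 // addrC subrK.
  apply: eq_bigr => i _; rewrite ltnNge leq_addl /= addnK.
  by rewrite nth_mktuple.
rewrite /dev avg_tuple.
transitivity (avg (fun x0 : {ffun 'I_d.+1 -> G} =>
  avg (fun y : {ffun 'I_(k - d.+1) -> G} => th (\sum_i x0 i + \sum_i y i)))).
  apply: eq_avg => x0; rewrite avg_tuple (avg_shift x0).
  under eq_avg do rewrite avg_tuple.
  rewrite exchange_avg; apply: eq_avg => y; apply: eq_avg => x1.
  apply: eq_bigr => w _; rewrite /balanced /cayley sumE.
  congr ((_ + _ \in A)%:R - _).
  by apply: eq_bigr => i _; rewrite addrK.
rewrite exchange_avg -[RHS](avg_cst [ffun _ : 'I_(k - d.+1) => 0 : G]).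
apply: eq_avg => y.
rewrite (avg_proj (p := fun x : {ffun 'I_d.+1 -> G} => \sum_i x i)
  (e := fun t => [ffun i => if i == ord0 then t else 0])
  (fun s => th (s + \sum_i y i))); last first.
  by move=> x t; rewrite -!sum_setT sum_single_coord ?inE.
by rewrite -avg_shift.
Qed.

Lemma cutnorm_pred (R : realType) (G : finZmodType) k d
    (F : {ffun 'I_k -> G} -> R) (p : dsets k d -> pred {ffun 'I_k -> G}) :
  (forall B, depends_on (val B) (fun x => (p B x)%:R : R)) ->
  `|avg (fun x => F x * \prod_B (p B x)%:R)| <= cutnorm d F.
Proof.
move=> dp.
pose S : {dffun forall B : dsets k d, {set {ffun {i | i \in val B} -> G}}} :=
  [ffun B => [set restrx (val B) x | x in p B]].
apply: le_trans (le_bigmax _ _ S); rewrite le_eqVlt; apply/orP; left; apply/eqP.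
congr `|_|; apply: eq_avg => x; congr (_ * _); apply: eq_bigr => B _.
congr (nat_of_bool _)%:R; rewrite ffunE; apply/idP/imsetP => [pBx|[y]].
  by exists x.
rewrite unfold_in => pBy xy; have := dp B x y; rewrite pBy.
have agree j : j \in val B -> x j = y j.
  by move=> jB; move/ffunP/(_ (exist _ j jB)): xy; rewrite !ffunE.
by move/(_ agree)/eqP; case: (p B x) => //; rewrite eq_sym oner_eq0.
Qed.

(** The functions are traded for indicators one after the other by [avg_depends_split], at a factor
    2 each. *)
Lemma cutnorm_fun (R : realType) (G : finZmodType) k d
    (F : {ffun 'I_k -> G} -> R) (v : dsets k d -> {ffun 'I_k -> G} -> R) :
  (forall B, depends_on (val B) (v B) /\ bounded1 (v B)) ->
  `|avg (fun x => F x * \prod_B v B x)| <= 2 ^+ 'C(k, d) * cutnorm d F.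
Proof.
move=> vP.
suff H (r : seq (dsets k d)) (p : dsets k d -> pred {ffun 'I_k -> G}) : uniq r ->
    (forall B, depends_on (val B) (fun x => (p B x)%:R : R)) ->
    `|avg (fun x => F x * \prod_B (if B \in r then v B x else (p B x)%:R))|
      <= 2 ^+ size r * cutnorm d F.
  have := H (enum {: dsets k d}) (fun _ _ => true) (enum_uniq _).
  rewrite -cardE card_dsets.
  by under eq_avg do under eq_bigr do rewrite mem_enum /=; apply.
elim: r p => [|B r IHr] p /= => [_ dp|/andP[Br ur] dp].
  by rewrite mul1r; exact: cutnorm_pred.
pose H x := F x * \prod_(C | C != B) (if C \in r then v C x else (p C x)%:R).
have [dv v1] := vP B; have [q dq le_q] := avg_depends_split H dv v1.
apply: le_trans (_ : `|avg (fun x => v B x * H x)| <= _).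
  rewrite le_eqVlt; apply/orP; left; apply/eqP; congr `|_|; apply: eq_avg => x.
  rewrite /H (bigD1 B) //= mem_head mulrCA; congr (_ * (_ * _)).
  by apply: eq_bigr => C CB; rewrite in_cons (negbTE CB).
apply: le_trans le_q _; rewrite big_bool exprS -mulrA mulr_natl mulr2n.
have step s : `|avg (fun x => (q s x)%:R * H x)| <= 2 ^+ size r * cutnorm d F.
  apply: le_trans (IHr (fun C => if C == B then q s else p C) ur _).
    rewrite le_eqVlt; apply/orP; left; apply/eqP; congr `|_|; apply: eq_avg => x.
    rewrite /H [in RHS](bigD1 B) //= (negbTE Br) eqxx mulrCA; congr (_ * (_ * _)).
    by apply: eq_bigr => C CB; rewrite (negbTE CB).
  by move=> C; case: eqP => [->|_]; [exact: dq | exact: dp].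
by apply: lerD.
Qed.

(** * The hypergraph of the linear system *)

Section PhiGraph.
Variables k d : nat.
Hypothesis hk : (d < k)%N.
Implicit Types s : {ffun dsets k d -> bool}.

Definition phi_vertex s (j : 'I_k) : 'I_#|{: Jkd k d}| :=
  enum_rank (Tagged (fun j => {ffun dsets_out d j -> bool}) (restr s j) : Jkd k d).

Definition phi_edge s : {set 'I_#|{: Jkd k d}|} := [set phi_vertex s j | j in 'I_k].

Lemma phi_vertex_eq s s' j j' : phi_vertex s j = phi_vertex s' j' ->
  j = j' /\ restr s j = restr s' j.
Proof.
move=> /enum_rank_inj E.
have jj' : j = j' by exact: (congr1 tag E).
by split=> //; move: E; rewrite -jj' => /eqP; rewrite eq_Tagged => /eqP.
Qed.

Lemma phi_vertex_inj s : injective (phi_vertex s).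
Proof. by move=> j j' /phi_vertex_eq[]. Qed.

Lemma card_phi_edge s : #|phi_edge s| = k.
Proof. by rewrite card_imset ?card_ord //; exact: phi_vertex_inj. Qed.

(** If [s] and [s'] differ at [B], a common vertex must have its index in [B]: for an index outside
    [B], the restrictions still record the value at [B]. *)
Lemma card_phi_edgeI s s' : s != s' -> (#|phi_edge s :&: phi_edge s'| <= d)%N.
Proof.
move=> ss'; have [B sB] : exists B, s B != s' B.
  apply/existsP; apply: contraNT ss'; rewrite negb_exists => /forallP ss'.
  by apply/eqP/ffunP => B; apply/eqP; rewrite -[_ == _]negbK.
have cardB : #|phi_vertex s @: val B| = d.
  by rewrite card_imset ?(eqP (valP B)) //; exact: phi_vertex_inj.
apply: leq_trans (eq_leq cardB); apply: subset_leq_card; apply/subsetP => v /setIP[/imsetP[j _ ->]].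
move=> /imsetP[j' _ /phi_vertex_eq[_ rj]]; apply: imset_f.
apply: contraNT sB => jB.
have BP : (#|val B| == d) && (j \notin val B) by rewrite (valP B).
move/ffunP/(_ (exist _ (val B) BP)): rj; rewrite !ffunE.
set C := exist _ _ _; suff -> : C = B by move=> ->.
exact: val_inj.
Qed.

Lemma phi_edge_inj : injective phi_edge.
Proof.
move=> s s' E; apply/eqP; apply: contraT => /card_phi_edgeI.
by rewrite E setIid card_phi_edge leqNgt hk.
Qed.

Definition phi_graph : {set {set 'I_#|{: Jkd k d}|}} :=
  [set phi_edge s | s : {ffun dsets k d -> bool}].

Lemma card_phi_graph : #|phi_graph| = (2 ^ 'C(k, d))%N.
Proof.
by rewrite card_imset ?card_ffun ?card_bool ?card_dsets //; exact: phi_edge_inj.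
Qed.

Lemma kgraph_phi_graph : kgraph k phi_graph.
Proof. by apply/forall_inP => _ /imsetP[s _ ->]; rewrite card_phi_edge. Qed.

Lemma dlinear_phi_graph : dlinear d phi_graph.
Proof.
apply/forall_inP => _ /imsetP[s _ ->]; apply/forall_inP => _ /imsetP[s' _ ->].
by apply/implyP => ss'; apply: card_phi_edgeI; apply: contraNneq ss' => ->.
Qed.

Lemma hom_density_phi_graph (R : realType) (G : finZmodType) (A : {set G}) :
  hom_density phi_graph (@cayley R G k A) =
  avg (fun x : {ffun Jkd k d -> G} =>
         [forall s : {ffun dsets k d -> bool}, phi s x \in A]%:R).
Proof.
rewrite [RHS](@avg_bij _ _ _ (fun x : {ffun 'I_#|{: Jkd k d}| -> G} =>
  [ffun q => x (enum_rank q)])); last first.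
  exists (fun x : {ffun Jkd k d -> G} => [ffun i => x (enum_val i)]) => x.
    by apply/ffunP => i; rewrite !ffunE enum_valK.
  by apply/ffunP => q; rewrite !ffunE enum_rankK.
apply: eq_avg => x /=; rewrite -prod_bool big_imset /=; last first.
  by move=> s s' _ _; exact: phi_edge_inj.
apply: eq_bigr => s _; rewrite cayley_edge ?card_phi_edge //.
congr (nat_of_bool (_ \in A))%:R; rewrite big_imset /=; last first.
  by move=> j j' _ _; exact: phi_vertex_inj.
by apply: eq_bigr => j _; rewrite ffunE.
Qed.

End PhiGraph.

(** * The squashed octahedron *)

Section Octahedron.
Variables k d : nat.
Hypothesis hk : (d < k)%N.
Implicit Types w : {ffun 'I_d.+1 -> bool}.

Lemma oct_vertex_subproof (i : 'I_d.+1) (c : bool) : (2 * i + c < oct_n k d)%N.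
Proof. by rewrite /oct_n; have := ltn_ord i; case: c; lia. Qed.

Definition oct_vertex i c : 'I_(oct_n k d) := Ordinal (oct_vertex_subproof i c).

Definition oct_tail : {set 'I_(oct_n k d)} := [set v | (2 * d.+1 <= val v)%N].

Lemma oct_vertex_eq i c i' c' : oct_vertex i c = oct_vertex i' c' -> i = i' /\ c = c'.
Proof.
move=> /(congr1 val) /= E.
have ii' : i = i' by apply: val_inj => /=; case: c c' E => -[]; lia.
by split=> //; case: c c' E => -[] //; rewrite ii'; lia.
Qed.

Lemma oct_vertex_tail i c : oct_vertex i c \notin oct_tail.
Proof. by rewrite inE /= -ltnNge; have := ltn_ord i; case: c; lia. Qed.

Lemma oct_edgeE w :
  oct_edge k d w = [set oct_vertex i (w i) | i in 'I_d.+1] :|: oct_tail.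
Proof.
apply/setP => v; rewrite !inE; congr (_ || _).
apply/existsP/imsetP => [[i /eqP vi]|[i _ ->]].
  by exists i => //; apply: val_inj.
by exists i => /=.
Qed.

Lemma oct_edgeI w : [disjoint [set oct_vertex i (w i) | i in 'I_d.+1] & oct_tail].
Proof.
rewrite -setI_eq0; apply/eqP/setP => v; rewrite !inE; apply/negbTE/negP.
by move=> /andP[/imsetP[i _ ->]]; have := oct_vertex_tail i (w i); rewrite inE => /negP.
Qed.

Lemma oct_vertex_inj w : injective (fun i => oct_vertex i (w i)).
Proof. by move=> i i' /oct_vertex_eq[]. Qed.

Lemma mem_oct_edge w i c : (oct_vertex i c \in oct_edge k d w) = (c == w i).
Proof.
rewrite oct_edgeE inE (negbTE (oct_vertex_tail _ _)) orbF.
apply/imsetP/eqP => [[i' _ /oct_vertex_eq[-> ->]] //|->].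
by exists i.
Qed.

Lemma oct_edge_inj : injective (oct_edge k d).
Proof.
by move=> w w' E; apply/ffunP => i; apply/eqP; rewrite -mem_oct_edge -E mem_oct_edge.
Qed.

Lemma card_oct : #|oct k d| = (2 ^ d.+1)%N.
Proof.
by rewrite card_imset ?card_ffun ?card_bool ?card_ord //; exact: oct_edge_inj.
Qed.

Lemma card_oct_edge w : #|oct_edge k d w| = k.
Proof.
rewrite oct_edgeE cardsU (eqP _ : _ :&: _ = set0) ?setI_eq0 ?oct_edgeI //.
rewrite cards0 subn0 card_imset ?card_ord; last exact: oct_vertex_inj.
have -> : oct_tail = [set rshift (2 * d.+1) i | i in 'I_(k - d.+1)].
  apply/setP => v; rewrite inE; apply/idP/imsetP => [vt|[i _ ->]]; last first.
    by rewrite /= leq_addr.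
  have vk : (v - 2 * d.+1 < k - d.+1)%N by rewrite ltn_subLR //; exact: ltn_ord.
  by exists (Ordinal vk) => //; apply: val_inj; rewrite /= subnKC.
by rewrite card_imset ?card_ord ?subnKC //; exact: rshift_inj.
Qed.

Lemma kgraph_oct : kgraph k (oct k d).
Proof. by apply/forall_inP => _ /imsetP[w _ ->]; rewrite card_oct_edge. Qed.

(** The private set of an edge consists of its [d + 1] vertices outside the tail, which determine
    [w]. *)
Lemma ssimple_oct : ssimple d.+1 (oct k d).
Proof.
apply/forall_inP => _ /imsetP[w _ ->].
apply/existsP; exists [set oct_vertex i (w i) | i in 'I_d.+1].
rewrite card_imset ?card_ord ?eqxx; last exact: oct_vertex_inj.
rewrite oct_edgeE subsetUl /=; apply/forall_inP => _ /imsetP[w' _ ->].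
apply/implyP; rewrite -oct_edgeE => ww'; apply: contra ww' => /subsetP sub.
apply/eqP; congr oct_edge; apply/ffunP => i; apply/esym/eqP.
by rewrite -mem_oct_edge; apply/sub/imset_f.
Qed.

Section MissingOne.
Implicit Types j : 'I_d.+1.

Lemma card_setC1_ord j : #|~: [set j]| == d.
Proof. by rewrite cardsC1 card_ord. Qed.

Lemma setC1_out_subproof j : (#|~: [set j]| == d) && (j \notin ~: [set j]).
Proof. by rewrite card_setC1_ord !inE eqxx. Qed.

Definition coset1 j : dsets d.+1 d :=
  exist (fun B : {set 'I_d.+1} => #|B| == d) _ (card_setC1_ord j).
Definition coset1_out j : dsets_out d j :=
  exist (fun B : {set 'I_d.+1} => (#|B| == d) && (j \notin B)) _
    (setC1_out_subproof j).

(** For [k = d + 1] a single [d]-set avoids [j], so the system has two variables per index, matching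
    the two octahedron vertices. *)
Lemma dsets_outE j (B : dsets_out d j) : B = coset1_out j.
Proof.
apply: val_inj; apply/eqP; have /andP[/eqP cB jB] := valP B.
rewrite eqEcard /= (eqP (card_setC1_ord j)) cB leqnn andbT.
apply/subsetP => i iB; rewrite !inE.
by apply: contraTneq iB => ->.
Qed.

Lemma dsetsE (B : dsets d.+1 d) : exists j, B = coset1 j.
Proof.
have [j jB] : exists j, j \notin val B.
  have : ~~ ([set: 'I_d.+1] \subset val B).
    by apply/negP => /subset_leq_card; rewrite cardsT card_ord (eqP (valP B)) ltnn.
  by case/subsetPn => j _; exists j.
have BP : (#|val B| == d) && (j \notin val B) by rewrite (valP B).
exists j; apply: val_inj.
exact: (congr1 val (dsets_outE (exist (fun C : {set 'I_d.+1} => (#|C| == d) && (j \notin C)) (val B) BP))).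
Qed.

End MissingOne.

(* The vertices [y] of the octahedron only translate the sum over an edge; their
   contribution is absorbed in the two vertices of index [ord0]. *)
Lemma hom_density_oct (R : realType) (G : finZmodType) (A : {set G}) :
  hom_density (oct k d) (@cayley R G k A) =
  avg (fun x : {ffun Jkd d.+1 d -> G} =>
         [forall s : {ffun dsets d.+1 d -> bool}, phi s x \in A]%:R).
Proof.
pose p (x : {ffun 'I_(oct_n k d) -> G}) : {ffun Jkd d.+1 d -> G} :=
  [ffun q : Jkd d.+1 d => x (oct_vertex (tag q) (tagged q (coset1_out (tag q)))) +
     if tag q == ord0 then \sum_(v in oct_tail) x v else 0].
(* A section of [p]: the vertex numbered [2 * j + c] is decoded by halving and parity, and the tail
   is set to 0. *)
pose e (z : {ffun Jkd d.+1 d -> G}) : {ffun 'I_(oct_n k d) -> G} :=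
  [ffun v : 'I_(oct_n k d) => if v \in oct_tail then 0 else
     z (Tagged (fun j => {ffun dsets_out d j -> bool})
       ([ffun=> odd v] : {ffun dsets_out d (inord v./2 : 'I_d.+1) -> bool}))].
have pe x z : p (x + e z) = p x + z.
  apply/ffunP => -[j t]; rewrite !ffunE /= (negbTE (oct_vertex_tail _ _)).
  set u := t _.
  have -> : \sum_(v in oct_tail) (x + e z) v = \sum_(v in oct_tail) x v.
    by apply: eq_bigr => v vt; rewrite !ffunE vt addr0.
  rewrite addrAC; congr (_ + _ + z _).
  have odd_v : odd (2 * j + u) = u by rewrite oddD oddM /= oddb.
  have half_v : inord (2 * j + u)./2 = j.
    by rewrite mul2n addnC half_bit_double inord_val.
  rewrite odd_v half_v; congr existT; apply/ffunP => B; rewrite ffunE.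
  by rewrite (dsets_outE B).
rewrite -(avg_proj (fun x : {ffun Jkd d.+1 d -> G} =>
  [forall s : {ffun dsets d.+1 d -> bool}, phi s x \in A]%:R) pe).
apply: eq_avg => x; rewrite -prod_bool big_imset /=; last first.
  by move=> w w' _ _; exact: oct_edge_inj.
pose c (s : {ffun dsets d.+1 d -> bool}) := [ffun j => s (coset1 j)].
have c_bij : bijective c.
  apply: inj_card_bij.
    move=> s s' ss'; apply/ffunP => B; have [j ->] := dsetsE B.
    by move/ffunP/(_ j): ss'; rewrite !ffunE.
  by rewrite !card_ffun card_dsets binSn !card_ord.
rewrite (reindex c) /=; last exact: onW_bij.
apply: eq_bigr => s _; rewrite cayley_edge ?card_oct_edge //.
congr (nat_of_bool (_ \in A))%:R.
rewrite oct_edgeE.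
rewrite (eq_bigl [in [predU [set oct_vertex i (c s i) | i in 'I_d.+1] & oct_tail]])
  => [|v]; last by rewrite !inE.
rewrite bigU ?oct_edgeI //= big_imset /=; last first.
  by move=> i i' _ _; exact: oct_vertex_inj.
rewrite /phi; under [in RHS]eq_bigr do rewrite ffunE /=.
rewrite big_split /=; congr (_ + _).
  apply: eq_bigr => j _; rewrite !ffunE; congr (x (oct_vertex _ (s _))).
  exact: val_inj.
by rewrite -big_mkcond big_pred1_eq.
Qed.

End Octahedron.

(** * Polynomial equivalence *)

Lemma ler_pow_div (R : realType) (eps : R) (K M C : nat) :
  0 < eps <= 1 -> (M <= K)%N -> (0 < C <= K)%N ->
  eps ^+ K / K%:R <= eps ^+ M / C%:R.
Proof.
move=> /andP[e0 e1] MK /andP[C0 CK].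
apply: ler_pM; rewrite ?exprn_ge0 ?invr_ge0 ?ler0n ?(ltW e0) //.
  by apply: ler_wiXn2l => //; exact: ltW.
by rewrite lef_pV2 ?posrE ?ltr0n ?ler_nat // (leq_trans C0).
Qed.

Lemma prod_along_dsets (R : realType) (Y : finType) k d (r : seq (dsets k d))
    (v : dsets k d -> {ffun 'I_k -> Y} -> R) :
  (forall B, depends_on (val B) (v B) /\ bounded1 (v B)) ->
  prod_along [seq val B | B <- r] (fun x => \prod_(B <- r) v B x).
Proof.
move=> vP; elim: r => [|B r IHr] /=.
  by apply: funext => x; rewrite big_nil.
exists (v B), (fun x => \prod_(C <- r) v C x); have [dv v1] := vP B; split=> //.
by apply: funext => x; rewrite big_cons.
Qed.

Lemma count_gowers_le (R : realType) k d : (d < k)%N ->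
  exists2 K : nat, (0 < K)%N &
  forall eps : R, 0 < eps <= 1 -> forall (G : finZmodType) (A : {set G}),
    avg (fun x : {ffun Jkd k d -> G} =>
           [forall s : {ffun dsets k d -> bool}, phi s x \in A]%:R)
      <= density R A ^+ (2 ^ 'C(k, d)) + eps ^+ K / K%:R ->
    gowers d.+1 (balanced R A) <= eps.
Proof.
move=> hk; have [n n0 cutP] := cut_gowers_le R hk.
(* The choice [t = eps ^+ n / 4] makes the bound [4 * t] of [davg_minimal] equal to [eps ^+ n]; its
   error [t ^+ M] is then [eps ^+ (n * M)] over [4 ^ M]. *)
pose M := dbl_exponent 'C(k, d); exists (n * M + 4 ^ M)%N.
  by rewrite addn_gt0 expn_gt0 orbT.
move=> eps e01 G A count; have /andP[e0 e1] := e01.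
rewrite -(@ler_pXn2r _ n) ?nnegrE ?powR_ge0 ?(ltW e0) //.
apply: cutP; first exact: balanced_bounded.
move=> v vP; have k0 := leq_ltn_trans (leq0n d) hk.
pose t := eps ^+ n / 4.
have t01 : 0 <= t <= 1.
  have := exprn_ge0 n (ltW e0); have : eps ^+ n <= 1 by rewrite exprn_ile1 ?(ltW e0).
  by rewrite /t; lra.
have -> : eps ^+ n = 4 * t by rewrite /t; lra.
apply: le_trans (@davg_minimal R k (dset_seq k d) G 0 (@cayley R G k A) t
  (fun x => \prod_B v B x) _ t01 _ _).
- rewrite avg_cayley // le_eqVlt; apply/orP; left; apply/eqP; congr `|_|.
- by move=> x; rewrite ler0n lern1 leq_b1.
- rewrite avg_cayley // size_dset_seq davg_cayley; apply: le_trans count _.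
  rewrite lerD2l -/M /t exprMn -exprM exprVn -natrX.
  by apply: ler_pow_div; rewrite ?leq_addr ?leq_addl ?expn_gt0.
have := prod_along_dsets (enum {: dsets k d}) vP.
by congr prod_along; apply: funext => x; rewrite big_enum.
Qed.

Lemma prop_le (R : realType) (G : finZmodType) k d (A : {set G}) (i : 'I_7) (c c' : R) :
  c <= c' -> prop k d A i c -> prop k d A i c'.
Proof.
move=> cc'; case: i => -[|[|[|[|[|[|[|]]]]]]] ? //; rewrite /prop /=.
- by move/le_trans; apply.
- by move=> h; apply: le_trans h _; rewrite lerD2l.
- by move/le_trans; apply.
- by move=> h n E Ek Ed; apply: le_trans (h n E Ek Ed) _; rewrite ler_wpM2l ?ler0n.
- by move=> h n E Ek Ed; apply: le_trans (h n E Ek Ed) _; rewrite ler_wpM2l ?ler0n.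
- by move=> h; apply: le_trans h _; rewrite lerD2l.
- by move/le_trans; apply.
Qed.

Lemma prop_gowers_le (R : realType) k d (i : 'I_7) : (d < k)%N ->
  exists2 K : nat, (0 < K)%N &
  forall eps : R, 0 < eps <= 1 -> forall (G : finZmodType) (A : {set G}),
    prop k d A i (eps ^+ K / K%:R) -> gowers d.+1 (balanced R A) <= eps.
Proof.
move=> hk; have [K1 K10 countP] := count_gowers_le R hk.
have linearP : exists2 K : nat, (0 < K)%N &
    forall eps : R, 0 < eps <= 1 -> forall (G : finZmodType) (A : {set G}),
    (forall (n : nat) (E : {set {set 'I_n}}), kgraph k E -> dlinear d E ->
       `| hom_density E (@cayley R G k A) - density R A ^+ #|E| |
         <= #|E|%:R * (eps ^+ K / K%:R)) -> gowers d.+1 (balanced R A) <= eps.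
  (* The test graph [phi_graph] has [2 ^ 'C(k, d)] edges; the denominator absorbs this factor. *)
  exists (K1 * 2 ^ 'C(k, d))%N; first by rewrite muln_gt0 K10 expn_gt0.
  move=> eps e01 G A /(_ _ _ (kgraph_phi_graph k d) (dlinear_phi_graph k d)).
  rewrite hom_density_phi_graph // card_phi_graph // ler_norml => /andP[_ count].
  apply: (countP eps e01); rewrite -lerBlDl; apply: le_trans count _.
  set N := (2 ^ _)%N; have N0 : N%:R != 0 :> R by rewrite pnatr_eq0 -lt0n expn_gt0.
  rewrite natrM invfM mulrCA [_^-1 / _]mulrC mulVKf //.
  have /andP[e0 e1] := e01; rewrite ler_wpM2r ?invr_ge0 ?ler0n //.
  by apply: ler_wiXn2l; rewrite ?leq_pmulr ?expn_gt0 ?(ltW e0).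
case: i => -[|[|[|[|[|[|[|]]]]]]] ? //; rewrite /prop /=.
- by exists 1%N => // eps _ G A; rewrite expr1 divr1.
- by exists K1.
- have [n n0 cutP] := cut_gowers_le R hk.
  exists (n + 2 ^ 'C(k, d))%N; first by rewrite addn_gt0 n0.
  move=> eps e01 G A cut; have /andP[e0 e1] := e01.
  rewrite -(@ler_pXn2r _ n) ?nnegrE ?powR_ge0 ?(ltW e0) //.
  apply: cutP => [|v vP]; first exact: balanced_bounded.
  apply: le_trans (cutnorm_fun
    (fun x => @cayley R G k A x - density R A) vP) _.
  rewrite mulrC -ler_pdivlMr ?exprn_gt0 // -natrX; apply: le_trans cut _.
  by apply: ler_pow_div; rewrite ?leq_addr ?leq_addl ?expn_gt0.
- have [K K0 KP] := linearP; exists K => // eps e01 G A simple.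
  by apply: (KP eps e01) => n E Ek Ed; apply: simple => //; exact: (dlinear_ssimple hk Ek Ed).
(* The octahedron count is the linear system count for [k = d + 1], whatever the actual [k]. *)
- have [K K0 KP] := count_gowers_le R (ltnSn d).
  exists K => // eps e01 G A; rewrite hom_density_oct // => octP.
  by apply: (KP eps e01); rewrite binSn.
- exists (2 ^ d.+1)%N; rewrite ?expn_gt0 // => eps e01 G A; rewrite dev_gavg // => devP.
  have /andP[e0 e1] := e01; rewrite gowers_le ?(ltW e0) //; apply: le_trans devP _.
  have := ler_pow_div (M := 2 ^ d.+1) (C := 1) e01 (leqnn _).
  by rewrite divr1 expn_gt0; apply.
Qed.

Lemma gowers_prop (R : realType) k d (j : 'I_7) (eps : R) (G : finZmodType)
    (A : {set G}) : (d < k)%N -> 0 < eps <= 1 ->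
  gowers d.+1 (balanced R A) <= eps / (2 ^ 'C(k, d) + 2 ^ d.+1)%:R ->
  prop k d A j eps.
Proof.
(* [K] dominates the edge counts of both [phi_graph] and [oct], whose density errors are not
   normalised in the properties concerned. *)
move=> hk /andP[e0 e1]; set K := (_ + _)%N => gK.
have K0 : 0 < K%:R :> R by rewrite ltr0n addn_gt0 expn_gt0.
have g0 : 0 <= gowers d.+1 (balanced R A) by exact: powR_ge0.
have gK' (n : nat) : (n <= K)%N -> n%:R * gowers d.+1 (balanced R A) <= eps.
  move=> nK; apply: le_trans (_ : K%:R * gowers d.+1 (balanced R A) <= _).
    by rewrite ler_wpM2r // ler_nat.
  by rewrite mulrC -ler_pdivlMr.
have gle : gowers d.+1 (balanced R A) <= eps.
  by rewrite -[leLHS]mul1r; apply: (gK' 1%N); rewrite -(ltr0n R).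
have simple n (E : {set {set 'I_n}}) : kgraph k E -> ssimple d.+1 E ->
    `|hom_density E (@cayley R G k A) - density R A ^+ #|E| | <= #|E|%:R * eps.
  move=> Ek Es; apply: le_trans (gowers_hom_density_le R A Ek Es) _.
  by rewrite ler_wpM2l ?ler0n.
case: j => -[|[|[|[|[|[|[|]]]]]]] ? //; rewrite /prop /=.
- rewrite -hom_density_phi_graph // -lerBlDl; apply: le_trans (ler_norm _) _.
  have := gowers_hom_density_le R A (kgraph_phi_graph k d)
    (dlinear_ssimple hk (kgraph_phi_graph k d) (dlinear_phi_graph k d)).
  rewrite card_phi_graph // => /le_trans; apply; apply: gK'; exact: leq_addr.
- exact: le_trans (gowers_cutnorm_le R A hk) gle.
- by move=> n E Ek Ed; apply: simple => //; exact: (dlinear_ssimple hk Ek Ed).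
- rewrite -lerBlDl; apply: le_trans (ler_norm _) _.
  have := gowers_hom_density_le R A (kgraph_oct hk) (ssimple_oct hk).
  rewrite card_oct // => /le_trans; apply; apply: gK'; exact: leq_addl.
- rewrite dev_gavg // -gowersX; apply: (le_trans _ gle).
  by rewrite -[leRHS]expr1 ler_wiXn2l ?expn_gt0 // (le_trans gle).
Qed.

Theorem theorem4p1 (R : realType) (k d : nat) (hd : (1 <= d)%N) (hk : (d.+1 <= k)%N) :
  exists K : R, 0 < K /\
    forall eps : R, 0 < eps <= 1 ->
    forall (G : finZmodType) (A : {set G}),
      K / eps `^ K <= #|G|%:R ->
      forall (i j : 'I_7) (c : R), 0 < c <= 1 -> c <= eps `^ K / K ->
        prop k d A i c -> prop k d A j eps.
Proof.
have /choice[K KP] : forall i : 'I_7, exists K : nat, (0 < K)%N /\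
    forall eps : R, 0 < eps <= 1 -> forall (G : finZmodType) (A : {set G}),
    prop k d A i (eps ^+ K / K%:R) -> gowers d.+1 (balanced R A) <= eps.
  by move=> i; have [K K0 KP] := prop_gowers_le R i hk; exists K.
pose K0 := (2 ^ 'C(k, d) + 2 ^ d.+1)%N.
have K0_gt0 : (0 < K0)%N by rewrite addn_gt0 expn_gt0.
(* The norm must drop below [eps / K0], so property [i] is used at that value; [L] dominates every
   exponent [K i] and every resulting denominator [K0 ^ K i * K i]. *)
pose L := (\sum_i (K i + K0 ^ K i * K i))%N.
have LK i : (K i <= L)%N /\ (0 < K0 ^ K i * K i <= L)%N.
  rewrite muln_gt0 expn_gt0 K0_gt0 (KP i).1 /L (bigD1 i) //=.
  by split; rewrite -addnA ?leq_addr // addnCA leq_addr.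
exists L%:R; split; first by rewrite ltr0n (leq_trans (KP ord0).1) ?(LK ord0).1.
move=> eps e01 G A _ i j c _; have /andP[e0 e1] := e01.
rewrite powR_mulrn ?(ltW e0) // => cL /(prop_le cL) Pi.
apply: gowers_prop => //; rewrite -/K0.
have K0R : 0 < K0%:R :> R by rewrite ltr0n.
have e01' : 0 < eps / K0%:R <= 1.
  by rewrite divr_gt0 // ler_pdivrMr // mul1r (le_trans e1) // ler1n.
apply: ((KP i).2 _ e01'); apply: prop_le Pi.
rewrite exprMn exprVn -mulrA -invfM -natrX -natrM.
by have [? ?] := LK i; exact: ler_pow_div.
Qed.
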